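(* Let $\{D_n\}_{n\in\mathbb{N}}$ be a system of Dedekind domains, $D=\bigcup_{n\in\mathbb{N}}D_n$ and $M$ a maximal ideal of $D$ such that $D_M$ is a DVR. (1) The following statements are equivalent: (a) $M$ is finitely generated; (b) $M$ is invertible; (c) $\mathrm{ht}(M[[X]])=1$; (d) $\mathrm{ht}(M[[X]])<\infty$. (2) $M$ is infinitely generated (i.e. not finitely generated) if and only if $\mathrm{ht}(M[[X]]/MD[[X]])\ge 2^{\aleph_1}$.
   Context: A system of Dedekind domains is a strictly increasing chain $D_1\subsetneq D_2\subsetneq D_3\subsetneq\cdots$ of Dedekind domains (each a subring of the next) such that: (i) each $D_j$ is not a field; (ii) for all $i<j$, each maximal ideal $P$ of $D_i$ survives in $D_j$, i.e. $PD_j\neq D_j$; (iii) for each $j\in\mathbb{N}$, each maximal ideal of $D_j$ contracts to a maximal ideal of $D_1$. Here $\mathbb{N}$ is the set of positive integers. A DVR is a principal ideal domain with exactly one nonzero maximal ideal. $D[[X]]$ is the power series ring over $D$; for an ideal $I$ of $D$, $I[[X]]=\{\sum_{i\ge 0}a_iX^i\mid a_i\in I \text{ for all } i\ge 0\}$, which contains $ID[[X]]$ and is a prime ideal of $D[[X]]$ when $I$ is prime; $M[[X]]/MD[[X]]$ is regarded as a prime ideal of the ring $D[[X]]/MD[[X]]$. The length of a chain $\mathcal{C}$ of prime ideals (a nonempty totally ordered set of primes) is $|\mathcal{C}|-1$, and for a cardinal $\alpha$, $\dim A\ge\alpha$ means that there is a chain of prime ideals of the ring $A$ of length $\ge\alpha$.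 The height of a prime ideal $P$ of $A$ is $\mathrm{ht}P=\dim A_P$. *)

(* Defs.v *)
From HB Require Import structures.
From mathcomp Require Import all_boot all_order all_algebra.
From mathcomp Require Import generic_quotient ring_quotient fraction mxpoly ring.
From mathcomp Require Import mathcomp_extra boolp classical_sets functions.
From mathcomp Require Import cardinality wochoice.

Set Implicit Arguments.
Unset Strict Implicit.
Unset Printing Implicit Defensive.

Import GRing.Theory.
Local Open Scope ring_scope.
Local Open Scope quotient_scope.
Local Open Scope classical_set_scope.
Local Open Scope card_scope.

Section Ideals.
Variable A : comPzRingType.
Implicit Types I J P C : set A.

Definition is_ideal I :=
  [/\ I 0, forall x y, I x -> I y -> I (x + y) & forall a x, I x -> I (a * x)].

Definition is_prime P :=
  [/\ is_ideal P, P <> setT & forall x y, P (x * y) -> P x \/ P y].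

Definition is_maximal P :=
  [/\ is_ideal P, P <> setT &
      forall J, is_ideal J -> P `<=` J -> J = P \/ J = setT].

Definition ideal_gen I : set A := smallest is_ideal I.

Definition finitely_generated I := exists s : seq A, I = ideal_gen [set` s].

Definition mult_closed I := I 1 /\ forall x y, I x -> I y -> I (x * y).

Definition mult_gen I : set A := smallest mult_closed I.

Lemma ideal_gen_ideal I : is_ideal (ideal_gen I).
Proof.
split=> [J [[]]//|x y Ix Iy J [Ji IJ]|a x Ix J [Ji IJ]]; case: (Ji) => _ JD JM.
  by apply: JD; [exact: (Ix J)|exact: (Iy J)].
by apply: JM; exact: (Ix J).
Qed.

Lemma mult_gen_closed I : mult_closed (mult_gen I).
Proof.
split=> [J [[]]//|x y Ix Iy J [Ji IJ]]; case: (Ji) => _ JM.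
by apply: JM; [exact: (Ix J)|exact: (Iy J)].
Qed.

End Ideals.

(* A / (I), for an arbitrary subset I.  The library makes {ideal_quot _} a ring
   only for proper ideals of nonzero rings, so only its additive part is used. *)
Section QuotientRing.
Variables (A : comPzRingType) (I : set A).

Definition ideal_pred : {pred A} := fun x => `[< ideal_gen I x >].

Lemma ideal_pred_zmod : zmod_closed ideal_pred.
Proof.
have [I0 ID IM] := ideal_gen_ideal I; split; first exact/asboolP.
move=> x y /asboolP Ix /asboolP Iy; apply/asboolP; apply: ID => //.
by rewrite -mulN1r; apply: IM.
Qed.

HB.instance Definition _ := GRing.isZmodClosed.Build A ideal_pred ideal_pred_zmod.

Definition quot_ring := Quotient.quot ideal_pred.
HB.instance Definition _ := GRing.Zmodule.on quot_ring.

Definition quot_map (x : A) : quot_ring := \pi_(Quotient.quot ideal_pred) x.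
Definition quot_repr (x : quot_ring) : A := repr (x : Quotient.quot ideal_pred).

Lemma quot_reprK : cancel quot_repr quot_map.
Proof. by move=> x; exact: (@reprK _ (Quotient.quot ideal_pred)). Qed.

Lemma quot_mapP x y : quot_map x = quot_map y <-> ideal_gen I (x - y).
Proof.
split=> [/eqP|h]; first by rewrite /quot_map -Quotient.idealrBE => /asboolP.
by apply/eqP; rewrite /quot_map -Quotient.idealrBE; apply/asboolP.
Qed.

Lemma quot_mapD : {morph quot_map : x y / x + y}.
Proof. by move=> x y; rewrite /quot_map raddfD. Qed.

Definition quot_one : quot_ring := quot_map 1.
Definition quot_mul (x y : quot_ring) : quot_ring :=
  quot_map (quot_repr x * quot_repr y).

Lemma quot_mapM x y : quot_map (x * y) = quot_mul (quot_map x) (quot_map y).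
Proof.
have [_ ID IM] := ideal_gen_ideal I.
rewrite /quot_mul; apply/quot_mapP.
set x' := quot_repr _; set y' := quot_repr _.
have hx : ideal_gen I (x - x') by apply/quot_mapP; rewrite quot_reprK.
have hy : ideal_gen I (y - y') by apply/quot_mapP; rewrite quot_reprK.
have -> : x * y - x' * y' = y * (x - x') + x' * (y - y').
  by rewrite !mulrBr addrA (mulrC x' y) subrK (mulrC y x).
by apply: ID; apply: IM.
Qed.

Lemma quot_mulA : associative quot_mul.
Proof.
move=> x y z; rewrite -[x]quot_reprK -[y]quot_reprK -[z]quot_reprK.
by rewrite -!quot_mapM mulrA.
Qed.

Lemma quot_mulC : commutative quot_mul.
Proof.
move=> x y; rewrite -[x]quot_reprK -[y]quot_reprK.
by rewrite -!quot_mapM mulrC.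
Qed.

Lemma quot_mul1 : left_id quot_one quot_mul.
Proof.
by move=> x; rewrite -[x]quot_reprK /quot_one -quot_mapM mul1r.
Qed.

Lemma quot_mulD : left_distributive quot_mul +%R.
Proof.
move=> x y z; rewrite -[x]quot_reprK -[y]quot_reprK -[z]quot_reprK.
by rewrite -quot_mapD -!quot_mapM -quot_mapD mulrDl.
Qed.

HB.instance Definition _ := GRing.Zmodule_isComPzRing.Build quot_ring
  quot_mulA quot_mulC quot_mul1 quot_mulD.

End QuotientRing.

(* The ring of fractions of A with denominators in the multiplicative submonoid
   generated by an arbitrary subset S; A is not assumed to be a domain. *)
Section Fractions.
Variables (A : comPzRingType) (S : set A).

Definition pre_frac := (A * mult_gen S)%type.
Implicit Types a b c : pre_frac.

Definition numer a : A := a.1.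
Definition denom a : A := val a.2.

Definition frac_eq : rel pre_frac := fun a b =>
  `[< exists2 u, mult_gen S u & u * (numer a * denom b) = u * (numer b * denom a) >].

Lemma denomP a : mult_gen S (denom a).
Proof. exact: set_valP. Qed.

Lemma mult_gen1 : mult_gen S 1.
Proof. exact: (mult_gen_closed S).1. Qed.

Lemma mult_genM u v : mult_gen S u -> mult_gen S v -> mult_gen S (u * v).
Proof. exact: (mult_gen_closed S).2. Qed.

Lemma frac_eq_equiv : equiv_class_of frac_eq.
Proof.
split=> [a|a b|b a c]; first by apply/asboolP; exists 1 => //; exact: mult_gen1.
  by apply/asboolP/asboolP => -[u Su e]; exists u.
move=> /asboolP[u Su e] /asboolP[v Sv f]; apply/asboolP.
exists (u * v * denom b).
  by apply: mult_genM (denomP b); exact: mult_genM.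
transitivity (v * denom c * (u * (numer a * denom b))); first by ring.
rewrite e; transitivity (u * denom a * (v * (numer b * denom c))); first by ring.
by rewrite f; ring.
Qed.

Canonical frac_eq_equiv_rel := EquivRelPack frac_eq_equiv.
Canonical frac_eq_enc := defaultEncModRel frac_eq.

Definition fractions := {eq_quot frac_eq}.
HB.instance Definition _ := Choice.on fractions.

Definition mk_pre_frac (x y : A) (Sy : mult_gen S y) : pre_frac :=
  (x, SigSub (mem_set Sy)).

Definition to_frac a : fractions := \pi_{eq_quot frac_eq} a.
Definition frac_repr (x : fractions) : pre_frac := repr (x : {eq_quot frac_eq}).

Lemma frac_reprK x : to_frac (frac_repr x) = x.
Proof. exact: (@reprK _ {eq_quot frac_eq}). Qed.

Lemma to_fracP a b : to_frac a = to_frac b <->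
  exists2 u, mult_gen S u & u * (numer a * denom b) = u * (numer b * denom a).
Proof.
split=> [/eqP|h]; first by rewrite /to_frac eqmodE => /asboolP.
by apply/eqP; rewrite /to_frac eqmodE; apply/asboolP.
Qed.

Lemma to_frac_eq a b :
  numer a * denom b = numer b * denom a -> to_frac a = to_frac b.
Proof. by move=> e; apply/to_fracP; exists 1; [exact: mult_gen1|rewrite e]. Qed.

Definition pre_add a b : pre_frac :=
  mk_pre_frac (numer a * denom b + numer b * denom a)
    (mult_genM (denomP a) (denomP b)).
Definition pre_mul a b : pre_frac :=
  mk_pre_frac (numer a * numer b) (mult_genM (denomP a) (denomP b)).
Definition pre_opp a : pre_frac := mk_pre_frac (- numer a) (denomP a).
Definition pre_cst (x : A) : pre_frac := mk_pre_frac x mult_gen1.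

Lemma numer_denomE :
  (forall a b, numer (pre_add a b) = numer a * denom b + numer b * denom a) *
  (forall a b, denom (pre_add a b) = denom a * denom b) *
  (forall a b, numer (pre_mul a b) = numer a * numer b) *
  (forall a b, denom (pre_mul a b) = denom a * denom b) *
  (forall a, numer (pre_opp a) = - numer a) *
  (forall a, denom (pre_opp a) = denom a) *
  (forall x, numer (pre_cst x) = x) * (forall x, denom (pre_cst x) = 1).
Proof. by []. Qed.

Definition frac_map (x : A) : fractions := to_frac (pre_cst x).
Definition frac_add x y : fractions :=
  to_frac (pre_add (frac_repr x) (frac_repr y)).
Definition frac_mul x y : fractions :=
  to_frac (pre_mul (frac_repr x) (frac_repr y)).
Definition frac_opp x : fractions := to_frac (pre_opp (frac_repr x)).

Lemma frac_reprP a : exists2 u, mult_gen S u &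
  u * (numer (frac_repr (to_frac a)) * denom a) =
  u * (numer a * denom (frac_repr (to_frac a))).
Proof. by apply/to_fracP; rewrite frac_reprK. Qed.

Lemma to_fracD a b : frac_add (to_frac a) (to_frac b) = to_frac (pre_add a b).
Proof.
have [u Su] := frac_reprP a; have [v Sv] := frac_reprP b; rewrite /frac_add.
move: (frac_repr (to_frac a)) (frac_repr (to_frac b)) => a' b' ev eu.
apply/to_fracP; exists (u * v); [exact: mult_genM|rewrite !numer_denomE].
transitivity (v * denom b' * denom b * (u * (numer a' * denom a)) +
              u * denom a' * denom a * (v * (numer b' * denom b))); first by ring.
by rewrite eu ev; ring.
Qed.

Lemma to_fracM a b : frac_mul (to_frac a) (to_frac b) = to_frac (pre_mul a b).
Proof.
have [u Su] := frac_reprP a; have [v Sv] := frac_reprP b; rewrite /frac_mul.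
move: (frac_repr (to_frac a)) (frac_repr (to_frac b)) => a' b' ev eu.
apply/to_fracP; exists (u * v); [exact: mult_genM|rewrite !numer_denomE].
transitivity ((u * (numer a' * denom a)) * (v * (numer b' * denom b))).
  by ring.
by rewrite eu ev; ring.
Qed.

Lemma to_fracN a : frac_opp (to_frac a) = to_frac (pre_opp a).
Proof.
have [u Su] := frac_reprP a; rewrite /frac_opp.
move: (frac_repr (to_frac a)) => a' eu.
apply/to_fracP; exists u => //; rewrite !numer_denomE.
by rewrite !mulNr !mulrN eu.
Qed.

Let to_fracE := (to_fracD, to_fracM, to_fracN).

Lemma frac_addA : associative frac_add.
Proof.
move=> x y z; rewrite -[x]frac_reprK -[y]frac_reprK -[z]frac_reprK !to_fracE.
by apply: to_frac_eq; rewrite !numer_denomE; ring.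
Qed.

Lemma frac_addC : commutative frac_add.
Proof.
move=> x y; rewrite -[x]frac_reprK -[y]frac_reprK !to_fracE.
by apply: to_frac_eq; rewrite !numer_denomE; ring.
Qed.

Lemma frac_add0 : left_id (frac_map 0) frac_add.
Proof.
move=> x; rewrite -[x]frac_reprK !to_fracE.
by apply: to_frac_eq; rewrite !numer_denomE; ring.
Qed.

Lemma frac_addN : left_inverse (frac_map 0) frac_opp frac_add.
Proof.
move=> x; rewrite -[x]frac_reprK !to_fracE.
by apply: to_frac_eq; rewrite !numer_denomE; ring.
Qed.

HB.instance Definition _ := GRing.isZmodule.Build fractions
  frac_addA frac_addC frac_add0 frac_addN.

Lemma frac_mulA : associative frac_mul.
Proof.
move=> x y z; rewrite -[x]frac_reprK -[y]frac_reprK -[z]frac_reprK !to_fracE.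
by apply: to_frac_eq; rewrite !numer_denomE; ring.
Qed.

Lemma frac_mulC : commutative frac_mul.
Proof.
move=> x y; rewrite -[x]frac_reprK -[y]frac_reprK !to_fracE.
by apply: to_frac_eq; rewrite !numer_denomE; ring.
Qed.

Lemma frac_mul1 : left_id (frac_map 1) frac_mul.
Proof.
move=> x; rewrite -[x]frac_reprK !to_fracE.
by apply: to_frac_eq; rewrite !numer_denomE; ring.
Qed.

Lemma frac_mulD : left_distributive frac_mul frac_add.
Proof.
move=> x y z; rewrite -[x]frac_reprK -[y]frac_reprK -[z]frac_reprK !to_fracE.
by apply: to_frac_eq; rewrite !numer_denomE; ring.
Qed.

HB.instance Definition _ := GRing.Zmodule_isComPzRing.Build fractions
  frac_mulA frac_mulC frac_mul1 frac_mulD.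

End Fractions.

(* A_P. For a prime ideal P the complement is already multiplicatively closed. *)
Definition localization (A : comPzRingType) (P : set A) : comPzRingType :=
  fractions (~` P).

Section Dimension.
Variable A : comPzRingType.

Definition prime_chain (C : set (set A)) :=
  [/\ C !=set0, C `<=` @is_prime A & total_on C subset].

(* dim A >= alpha, the cardinal alpha being given by a set S of that
   cardinality: removing any one element of a chain C leaves |C| - 1 elements. *)
Definition dim_ge {U} (S : set U) := exists C : set (set A),
  prime_chain C /\ exists2 P, C P & S #<= C `\ P.

End Dimension.

Definition height_ge {A : comPzRingType} (P : set A) {U} (S : set U) :=
  dim_ge (localization P) S.

Definition height_eq {A : comPzRingType} (P : set A) (n : nat) :=
  height_ge P `I_n /\ ~ height_ge P `I_n.+1.

Definition height_finite {A : comPzRingType} (P : set A) :=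
  exists n, height_eq P n.

Definition is_domain (A : comPzRingType) :=
  (1 : A) <> 0 /\ GRing.integral_domain_axiom A.

Definition is_pid (A : comPzRingType) :=
  is_domain A /\ forall I : set A, is_ideal I -> exists a, I = ideal_gen [set a].

Definition is_dvr (A : comPzRingType) :=
  is_pid A /\ exists! m : set A, is_maximal m /\ m <> [set 0].

Section PowerSeries.
Variable A : comPzRingType.

Record power_series := PowerSeries { coefs : nat -> A }.

HB.instance Definition _ := [isNew for coefs].
HB.instance Definition _ := [Choice of power_series by <:].
Implicit Types f g h : power_series.

Lemma psP f g : (forall n, coefs f n = coefs g n) -> f = g.
Proof. by case: f => f; case: g => g /= /funext ->. Qed.

Definition ps_cst (a : A) := PowerSeries (fun n => if n == 0%N then a else 0).
Definition ps_add f g := PowerSeries (fun n => coefs f n + coefs g n).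
Definition ps_opp f := PowerSeries (fun n => - coefs f n).
Definition ps_mul f g :=
  PowerSeries (fun n => \sum_(i < n.+1) coefs f i * coefs g (n - i)).

Lemma ps_addA : associative ps_add.
Proof. by move=> f g h; apply: psP => n; exact: addrA. Qed.
Lemma ps_addC : commutative ps_add.
Proof. by move=> f g; apply: psP => n; exact: addrC. Qed.
Lemma ps_add0 : left_id (ps_cst 0) ps_add.
Proof. by move=> f; apply: psP => n /=; rewrite if_same add0r. Qed.
Lemma ps_addN : left_inverse (ps_cst 0) ps_opp ps_add.
Proof. by move=> f; apply: psP => n /=; rewrite if_same addNr. Qed.

HB.instance Definition _ := GRing.isZmodule.Build power_series
  ps_addA ps_addC ps_add0 ps_addN.

Lemma coef_ps_mul f g n :
  coefs (ps_mul f g) n = \sum_(i < n.+1) coefs f i * coefs g (n - i).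
Proof. by []. Qed.

Lemma coef_ps_mul_rev f g n :
  coefs (ps_mul f g) n = \sum_(i < n.+1) coefs f (n - i) * coefs g i.
Proof.
rewrite /= (reindex_inj rev_ord_inj) /=.
by apply: eq_bigr => i _; rewrite (sub_ordK i).
Qed.

Lemma ps_mulA : associative ps_mul.
Proof.
move=> p q r; apply: psP => i; rewrite [LHS]coef_ps_mul [RHS]coef_ps_mul_rev.
pose coef3 j k := coefs p j * (coefs q (i - j - k) * coefs r k).
transitivity (\sum_(j < i.+1) \sum_(k < i.+1 | (k <= i - j)%N) coef3 j k).
  apply: eq_bigr => j _; rewrite coef_ps_mul_rev.
  by rewrite big_distrr /= (big_ord_narrow_leq (leq_subr _ _)).
rewrite (exchange_big_dep predT) //=; apply: eq_bigr => k _.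
transitivity (\sum_(j < i.+1 | (j <= i - k)%N) coef3 j k).
  apply: eq_bigl => j; rewrite -ltnS -(ltnS j) -!subSn ?leq_ord //.
  by rewrite -subn_gt0 -(subn_gt0 j) -!subnDA addnC.
rewrite (big_ord_narrow_leq (leq_subr _ _)) big_distrl /=.
by apply: eq_bigr => j _; rewrite /coef3 -!subnDA addnC mulrA.
Qed.

Lemma ps_mulC : commutative ps_mul.
Proof.
move=> f g; apply: psP => n; rewrite coef_ps_mul_rev /=.
by apply: eq_bigr => i _; rewrite mulrC.
Qed.

Lemma ps_mul1 : left_id (ps_cst 1) ps_mul.
Proof.
move=> f; apply: psP => n /=.
by rewrite big_ord_recl /= mul1r subn0 big1 ?addr0 // => i _; rewrite mul0r.
Qed.

Lemma ps_mulD : left_distributive ps_mul ps_add.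
Proof.
move=> f g h; apply: psP => n /=; rewrite -big_split /=.
by apply: eq_bigr => i _; rewrite mulrDl.
Qed.

HB.instance Definition _ := GRing.Zmodule_isComPzRing.Build power_series
  ps_mulA ps_mulC ps_mul1 ps_mulD.

(* I[[X]] *)
Definition ps_coefs_in (I : set A) : set power_series :=
  [set f | forall n, I (coefs f n)].

(* I A[[X]] *)
Definition ps_ext (I : set A) : set power_series := ideal_gen (ps_cst @` I).

End PowerSeries.

Section DedekindDomains.
Variable R : idomainType.
Local Notation K := {fraction R}.

Definition integrally_closed :=
  forall z : K, integralOver (@tofrac R) z -> range (@tofrac R) z.

Definition dedekind_domain :=
  [/\ forall I : set R, is_ideal I -> finitely_generated I,
      integrally_closed &
      forall P : set R, is_prime P -> P <> [set 0] -> is_maximal P].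

Definition not_a_field := exists2 x : R, x <> 0 & forall y : R, x * y <> 1.

Definition fractional_ideal (J : set K) :=
  [/\ J 0, forall x y, J x -> J y -> J (x + y),
      forall (a : R) x, J x -> J (tofrac a * x) &
      exists2 d : R, d <> 0 & forall x, J x -> range (@tofrac R) (tofrac d * x)].

Definition fractional_mul (I J : set K) : set K :=
  [set z | exists s : seq (K * K),
     (forall p, p \in s -> I p.1 /\ J p.2) /\ z = \sum_(p <- s) p.1 * p.2].

Definition invertible_ideal (I : set R) := exists2 J : set K,
  fractional_ideal J & fractional_mul (@tofrac R @` I) J = range (@tofrac R).

End DedekindDomains.

Section Subrings.
Variables (L : idomainType) (S : subringClosed L).

Definition subring := {x : L | x \in S}.

HB.instance Definition _ := SubChoice.on subring.
HB.instance Definition _ := [SubChoice_isSubComNzRing of subring by <:].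

Definition subring_unit : {pred subring} := fun x => `[< exists y, y * x = 1 >].
Definition subring_inv (x : subring) : subring :=
  if pselect (exists y, y * x = 1) is left h then projT1 (cid h) else x.

Lemma subring_mulVx : {in subring_unit, left_inverse 1 subring_inv *%R}.
Proof.
move=> x /asboolP xu; rewrite /subring_inv.
by case: pselect => // h; case: cid.
Qed.

Lemma subring_unitPl (x y : subring) : y * x = 1 -> subring_unit x.
Proof. by move=> e; apply/asboolP; exists y. Qed.

Lemma subring_invr_out : {in [predC subring_unit], subring_inv =1 id}.
Proof.
move=> x /negP xu; rewrite /subring_inv; case: pselect => // h.
by case: xu; apply/asboolP.
Qed.

HB.instance Definition _ := GRing.ComNzRing_hasMulInverse.Build subring
  subring_mulVx subring_unitPl subring_invr_out.

Lemma subring_integral : GRing.integral_domain_axiom subring.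
Proof.
move=> x y /(congr1 val); rewrite rmorphM rmorph0 => /eqP.
by rewrite mulf_eq0 => /orP[] /eqP e; apply/orP; [left|right]; apply/eqP/val_inj.
Qed.

HB.instance Definition _ :=
  GRing.ComUnitRing_isIntegral.Build subring subring_integral.

End Subrings.

Section Systems.
Variable L : idomainType.

(* For S included in T, the extension of I to T and the contraction of J to S. *)
Definition extension (S T : subringClosed L) (I : set (subring S)) :
    set (subring T) :=
  ideal_gen [set y | exists2 x, I x & val x = val y].

Definition contraction (S T : subringClosed L) (J : set (subring T)) :
    set (subring S) :=
  [set x | exists2 y, J y & val y = val x].

Arguments extension {S} T I.
Arguments contraction S {T} J.

(* The rings D_1, D_2, ... are numbered from 0. *)
Definition dedekind_system (Dn : nat -> subringClosed L) :=
  [/\ forall n, [set` Dn n] `<` [set` Dn n.+1],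
      forall n, dedekind_domain (subring (Dn n)),
      forall n, not_a_field (subring (Dn n)),
      forall i j, (i < j)%N -> forall P : set (subring (Dn i)),
        is_maximal P -> extension (Dn j) P <> setT &
      forall j (P : set (subring (Dn j))),
        is_maximal P -> is_maximal (contraction (Dn 0%N) P)].

End Systems.

(* The set of order types of well-orderings of subsets of nat, that is of
   countable ordinals: its cardinality is aleph_1. *)
Record countable_wo := CountableWo {
  wo_dom : nat -> bool;
  wo_rel : {n : nat | wo_dom n} -> {n : nat | wo_dom n} -> bool;
  wo_relP : well_order wo_rel }.

Definition wo_iso (r s : countable_wo) :=
  exists2 f : {n | wo_dom r n} -> {n | wo_dom s n},
    bijective f & {mono f : x y / wo_rel x y}.

Definition order_type (r : countable_wo) : set countable_wo := [set s | wo_iso r s].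

Definition aleph1 : set (set countable_wo) := range order_type.

(* 2 ^ aleph_1 *)
Definition two_aleph1 : set (set (set countable_wo)) := [set B | B `<=` aleph1].

(* Main.v *)
Require Import Defs.
From mathcomp Require Import all_boot all_order all_algebra.
From mathcomp Require Import fraction ring.
From mathcomp Require Import mathcomp_extra boolp classical_sets functions.
From mathcomp Require Import cardinality wochoice filter.

(* Write M_n for the intersection of M and D_n. If M is not finitely generated,
   then no M_n generates M, although M_n generates M D_M for large n; so every
   M_n lies in a maximal ideal of D other than M. This yields maximal
   ideals N_0, N_1, ... of D such that every element of D lies in M if and only
   if it lies in N_n for all large n, and elements e_n of M lying in all the N_m
   except N_n. Every sequence c with c_n > n is then the sequence of orders modulo
   N_n of some series f in M[[X]], namely the one whose i-th coefficient is the
   sum of the e_n with c_n = i. Modulo a nonprincipal ultrafilter the orders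
   modulo the N_n form a valuation with values in an ultrapower of the natural
   numbers, and its convex subgroups give primes between M D[[X]] and M[[X]].
   Countable gaps of growth rates can be filled, so transfinite recursion embeds
   the complete binary tree of height omega_1 in the order of growth rates; its
   2^aleph_1 branches determine distinct convex subgroups.
   If M is finitely generated, then t M is contained in p D for some t outside M,
   where p is a uniformizer at M. Hence D + (t/p) D is an inverse of M, and a
   nonzero f in a prime strictly below M[[X]] would have coefficients a with
   t^n a in p^n D for all n, which is impossible. *)

Set Implicit Arguments.
Unset Strict Implicit.
Unset Printing Implicit Defensive.

Import GRing.Theory.
Local Open Scope ring_scope.
Local Open Scope classical_set_scope.
Local Open Scope card_scope.

(** * Countable ordinals in an uncountable well-order *)

Lemma card_le_inj T U (A : set T) (B : set U) (f : T -> U) :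
  (forall x, A x -> B (f x)) ->
  (forall x y, A x -> A y -> f x = f y -> x = y) -> A #<= B.
Proof.
move=> fAB f_inj; have [g] : $|{injfun A >-> B}|.
  apply/injfunPex; exists f => // x y /set_mem Ax /set_mem Ay.
  exact: f_inj.
exact: inj_card_le g.
Qed.

(** [H] receives the earlier values as their graph, a set of pairs, so that its argument has the
    same type at every [x]. *)
Lemma wf_rec T Y (lt : T -> T -> Prop) (H : T -> set (T * Y) -> Y) :
  well_founded lt ->
  exists f, forall x, f x = H x [set p | lt p.1 x /\ p.2 = f p.1].
Proof.
move=> wf; pose G x (rec : forall y, lt y x -> Y) :=
  H x [set p | exists h : lt p.1 x, p.2 = rec p.1 h].
exists (Fix wf (fun=> Y) G) => x; rewrite Fix_eq => [|y f g fg].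
  congr (H x _); apply/seteqP; split=> p /= [] => [h ->|h e]; first by split.
  by exists h.
congr (H y _); apply/seteqP; split=> p /= [h ->]; exists h; rewrite fg //.
Qed.

Section WellOrder.
Variables (T : eqType) (R : rel T).
Hypothesis Rwo : well_order R.

Definition strict x y := R x y /\ x <> y.

Lemma wo_min (A : set T) : A !=set0 -> exists2 z, A z & forall x, A x -> R z x.
Proof.
move=> [a Aa]; have [|z [[zA lbA] _]] := @Rwo [pred x | `[< A x >]].
  by exists a; apply/asboolP.
exists z => [|x Ax]; first exact/asboolP.
by apply: lbA; apply/asboolP.
Qed.

Lemma wo_total x y : R x y \/ R y x.
Proof.
have [|z /= zA zP] := @wo_min [set w | w = x \/ w = y]; first by exists x; left.
by case: zA zP => -> zP; [left|right]; apply: zP; [right|left].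
Qed.

Lemma wo_refl x : R x x.
Proof. by case: (wo_total x x). Qed.

(** Both would be least in the pair [x], [y], and [well_order] makes the least element unique. *)
Lemma wo_anti x y : R x y -> R y x -> x = y.
Proof.
move=> xy yx; have [|z [_ Uz]] := @Rwo [pred w | (w == x) || (w == y)].
  by exists x; rewrite inE eqxx.
have zE w : w = x \/ w = y -> z = w.
  move=> e; apply: Uz; split.
    by rewrite inE; apply/orP; case: e => ->; rewrite eqxx; [left|right].
  by move=> v; rewrite inE => /orP[]/eqP->; case: e => -> //; exact: wo_refl.
by rewrite -(zE x) ?(zE y); [|right|left].
Qed.

Lemma strict_total x y : [\/ x = y, strict x y | strict y x].
Proof.
have [->|xy] := eqVneq x y; first by constructor 1.
have [h|h] := wo_total x y; [constructor 2|constructor 3].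
  by split=> // e; rewrite e eqxx in xy.
by split=> // e; rewrite e eqxx in xy.
Qed.

Lemma strict_asym x y : strict x y -> ~ R y x.
Proof. by move=> [xy n] yx; apply/n/wo_anti. Qed.

Lemma strictP x y : strict x y <-> ~ R y x.
Proof.
split=> [|nyx]; first exact: strict_asym.
case: (strict_total x y) => // [e|[]//].
by case: nyx; rewrite e; exact: wo_refl.
Qed.

Lemma wo_trans x y z : R x y -> R y z -> R x z.
Proof.
move=> xy yz.
have [|w /= wA wP] := @wo_min [set w | [\/ w = x, w = y | w = z]].
  by exists x; constructor 1.
case: wA wP => -> wP; first by apply: wP; constructor 3.
  by rewrite (wo_anti xy (wP _ _)) //; constructor 1.
have e : y = z by apply: wo_anti => //; apply: wP; constructor 2.
by rewrite -e.
Qed.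

Lemma strict_trans x y z : strict x y -> strict y z -> strict x z.
Proof.
move=> [xy n] [yz m]; split; first exact: wo_trans xy yz.
by move=> e; rewrite -e in yz; exact: n (wo_anti xy yz).
Qed.

Lemma strict_wf : well_founded strict.
Proof.
move=> x; apply: contrapT => nx.
have [z nz zP] := @wo_min [set w | ~ Acc strict w] (ex_intro _ x nx).
apply: nz; constructor => y yz; apply: contrapT => ny.
exact: strict_asym yz (zP y ny).
Qed.

Lemma strict_first (P : T -> Prop) :
  (exists x, P x) -> exists2 z, P z & forall x, strict x z -> ~ P x.
Proof.
move=> /wo_min[z Pz zP]; exists z => // x /strict_asym xz Px.
by apply: xz; exact: zP.
Qed.

(** When [T] is uncountable, this initial segment has order type omega_1. *)
Definition countable_initial : set T :=
  [set x | countable [set y | strict y x]].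

Lemma countable_initial_down x y :
  countable_initial x -> strict y x -> countable_initial y.
Proof.
move=> Sx yx; apply: sub_countable Sx; apply: subset_card_le => z /= zy.
exact: strict_trans zy yx.
Qed.

(** Either the segment is all of [T], or the first element outside it has uncountably many
    predecessors, all in the segment. *)
Lemma countable_initial_uncountable :
  ~ countable [set: T] -> ~ countable countable_initial.
Proof.
move=> uT cS; have [ST|] := pselect (forall x, countable_initial x).
  by apply: uT; apply: sub_countable cS; apply: subset_card_le => x _.
move=> /existsNP/strict_first[z nz zP]; apply: nz.
apply: sub_countable cS; apply: subset_card_le => y /= /zP.
exact: contrapT.
Qed.

End WellOrder.

Section Rank.
Variables (T : choiceType) (R : rel T).
Hypotheses (Rwo : well_order R) (uT : ~ countable [set: T]).
Local Notation S := (countable_initial R).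

(* [w] is the image of the order type of [Q] under the isomorphism of the
   countable ordinals with an initial segment of [R]. *)
Definition is_rank (X : eqType) (Q : rel X) (w : T) := exists f : X -> T,
  (forall x y, strict Q x y -> strict R (f x) (f y)) /\
  range f = [set v | strict R v w].

(** [f] sends [x] to the least element of the segment not yet taken; one is left because [X] is
    countable and the segment is not. The values fill an initial segment, and [w] is the first
    element after it. *)
Lemma rank_exists (X : eqType) (Q : rel X) : well_order Q ->
  countable [set: X] -> exists2 w, S w & is_rank Q w.
Proof.
move=> Qwo cX; have uS := countable_initial_uncountable Rwo uT.
have out (A : set T) : countable A ->
    exists2 w, S w /\ ~ A w & forall v, S v -> ~ A v -> R w v.
  move=> cA; have [|w Sw wP] := @wo_min _ _ Rwo [set w | S w /\ ~ A w].
    apply: contrapT => /forallNP h; apply: uS; apply: sub_countable cA.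
    apply: subset_card_le => w Sw; apply: contrapT => nA; exact: (h w).
  by exists w => // v Sv nAv; apply: wP.
have [w0 _ _] := out set0 (countable0 _).
pose H (x : X) (h : set (X * T)) := xget w0 [set w |
  (S w /\ ~ (snd @` h) w) /\ forall v, S v -> ~ (snd @` h) v -> R w v].
have [f fE] := wf_rec H (strict_wf Qwo).
have fP x : (S (f x) /\ (forall y, strict Q y x -> f y <> f x)) /\
    forall v, S v -> (forall y, strict Q y x -> f y <> v) -> R (f x) v.
  set h := [set p : X * T | strict Q p.1 x /\ p.2 = f p.1].
  have ch : countable (snd @` h).
    apply: sub_countable cX; apply: (card_le_trans _ (card_image_le f setT)).
    by apply: subset_card_le => _ [p [_ ->] <-]; exists p.1.
  have hE v : (snd @` h) v <-> exists2 y, strict Q y x & f y = v.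
    split=> [[p [px e] <-]|[y yx <-]]; first by exists p.1.
    by exists (y, f y).
  have [w Sw wP] := out _ ch; have [] := @xgetPex _ w0 [set w |
     (S w /\ ~ (snd @` h) w) /\ forall v, S v -> ~ (snd @` h) v -> R w v].
    by exists w.
  rewrite -/(H x h) -fE => -[Sf nf] fm; split; first split=> // y yx e.
    by apply: nf; apply/hE; exists y.
  move=> v Sv nv; apply: fm => // /hE[y yx e]; exact: nv yx e.
have fS x : S (f x) by have [[]] := fP x.
have f_mono x y : strict Q x y -> strict R (f x) (f y).
  move=> xy; have [[_ fy] _] := fP y; split; last exact: fy.
  have [_ fx] := fP x; apply: fx => // z zx; apply: fy.
  exact: strict_trans zx xy.
have f_init x v : strict R v (f x) -> range f v.
  move=> vx; have Sv := countable_initial_down Rwo (fS x) vx.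
  apply: contrapT => nv; apply: (strict_asym Rwo vx).
  by have [_] := fP x; apply=> // y _ e; apply: nv; exists y.
have [w [Sw nw] wP] := out (range f) (card_le_trans (card_image_le f _) cX).
exists w => //; exists f; split=> //; apply/seteqP; split=> v /=.
  move=> [x _ <-]; case: (strict_total Rwo (f x) w) => // [e|/f_init//].
  by case: nw; exists x.
move=> vw; apply: contrapT => nv; apply: (strict_asym Rwo vw).
apply: wP => //; exact: countable_initial_down Sw vw.
Qed.

Lemma strict_mono (X : eqType) (Q : rel X) (f : X -> T) : well_order Q ->
  (forall x y, strict Q x y -> strict R (f x) (f y)) ->
  injective f /\ {mono f : x y / Q x y >-> R x y}.
Proof.
move=> Qwo fm; have mono x y : Q x y = R (f x) (f y).
  apply/idP/idP => [xy|fxy].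
    have [->|/eqP n] := eqVneq x y; first exact: wo_refl.
    by have [] := fm x y (conj xy n).
  apply: contrapT => /(strictP Qwo)/fm/(strict_asym Rwo); exact.
split=> // x y e; apply: (wo_anti Qwo); rewrite mono e; exact: wo_refl.
Qed.

(** Two order embeddings with the same range differ by an isomorphism of their sources. *)
Lemma rank_iso (r s : countable_wo) w :
  is_rank (@wo_rel r) w -> is_rank (@wo_rel s) w -> wo_iso r s.
Proof.
move=> [f [fm fE]] [g [gm gE]].
have [f_inj fM] := strict_mono (@wo_relP r) fm.
have [g_inj gM] := strict_mono (@wo_relP s) gm.
have exg x : exists y, g y = f x.
  suff [y _ e] : range g (f x) by exists y.
  by rewrite gE -fE; exists x.
have exf y : exists x, f x = g y.
  suff [x _ e] : range f (g y) by exists x.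
  by rewrite fE -gE; exists y.
have [h hE] := boolp.choice exg; have [k kE] := boolp.choice exf.
exists h; first by exists k => [x|y]; [apply: f_inj|apply: g_inj]; rewrite ?kE ?hE.
by move=> x y; rewrite -fM -gM !hE.
Qed.

End Rank.

Lemma wo_iso_sym r s : wo_iso r s -> wo_iso s r.
Proof.
move=> [f [g fK gK] fm]; exists g; first by exists f.
by move=> x y; rewrite -fm !gK.
Qed.

Lemma wo_iso_trans r s t : wo_iso r s -> wo_iso s t -> wo_iso r t.
Proof.
move=> [f bf fm] [g bg gm]; exists (g \o f); first exact: bij_comp.
by move=> x y /=; rewrite gm fm.
Qed.

(** Each order type goes to the rank of one of its members; by [rank_iso], equal ranks come from
    equal order types. *)
Lemma aleph1_le (T : choiceType) (R : rel T) : well_order R ->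
  ~ countable [set: T] -> exists h : set countable_wo -> T,
    (forall t, aleph1 t -> countable_initial R (h t)) /\
    (forall t u, aleph1 t -> aleph1 u -> h t = h u -> t = u).
Proof.
move=> Rwo uT.
have rkP t : exists w, aleph1 t -> exists r, [/\ t = order_type r,
    countable_initial R w & is_rank R (@wo_rel r) w].
  have [[r _ <-]|nt] := pselect (aleph1 t).
    have [|w Sw rw] := rank_exists Rwo uT (@wo_relP r); last by exists w => _; exists r.
    exact: countableP.
  have [w _] : [set: T] !=set0.
    by apply/set0P; apply: contra_notN uT => /eqP->; exact: countable0.
  by exists w.
have [h hP] := boolp.choice rkP; exists h; split=> [t /hP[r []]//|t u At Au e].
have [r [tE _ rw]] := hP t At; have [s [uE _ sw]] := hP u Au.
rewrite -e in sw; rewrite tE uE; have rs := rank_iso Rwo rw sw.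
apply/seteqP; split=> v /=; first exact/wo_iso_trans/wo_iso_sym.
exact: wo_iso_trans.
Qed.

(** * Trees of growth rates *)

(** Landau's relation a = o(b), written without division. *)
Definition dominated (a b : nat -> nat) :=
  forall k, \oo [set n | (k * a n <= b n)%N].

(** The index set [J] leaves room for [A] to be empty or finite. *)
Lemma countable_enum T (x0 : T) (A : set T) : countable A ->
  exists (J : pred nat) (e : nat -> T),
    (forall i, J i -> A (e i)) /\ (forall a, A a -> exists2 i, J i & e i = a).
Proof.
move=> /countable_injP[f f_inj].
have exe i : exists x, (exists2 a, A a & f a = i) -> A x /\ f x = i.
  have [[a Aa fa]|h] := pselect (exists2 a, A a & f a = i); first by exists a.
  by exists x0.
have [e eP] := boolp.choice exe.
exists (fun i => `[< exists2 a, A a & f a = i >]), e; split.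
  by move=> i /asboolP/eP[].
move=> a Aa; exists (f a); first by apply/asboolP; exists a.
have [|Ae fe] := eP (f a); first by exists a.
by apply: f_inj fe; exact/mem_set.
Qed.

(* Countable gaps are filled by a diagonal argument: the k-th requirement
   involves finitely many functions only, hence holds from some point on. *)
Lemma dominated_interpolation (L U : set (nat -> nat)) :
  countable L -> countable U ->
  (forall l u, L l -> U u -> dominated l u) ->
  exists c, (forall l, L l -> dominated l c) /\ (forall u, U u -> dominated c u).
Proof.
move=> /(countable_enum (fun=> 0%N))[I [l [Il Ll]]].
move=> /(countable_enum (fun=> 0%N))[J [u [Ju Uu]]] LU.
(* Of the two factors [k.+1], one will separate the lower functions from [c], the other [c] from the
   upper functions. *)
pose good n k := [forall i : 'I_k.+1, forall j : 'I_k.+1,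
  (I i && J j) ==> (k.+1 ^ 2 * l i n <= u j n)%N].
have goodP n k : good n k -> forall i j, (i <= k)%N -> (j <= k)%N -> I i -> J j ->
    (k.+1 ^ 2 * l i n <= u j n)%N.
  move=> /forallP gd i j ik jk Ii Jj.
  move: (gd (Ordinal (ik : (i < k.+1)%N))) => /forallP.
  by move=> /(_ (Ordinal (jk : (j < k.+1)%N)))/implyP; apply; rewrite /= Ii.
have good_near k : \oo [set n | good n k].
  have goodij (i j : 'I_k.+1) :
      \oo [set n | (I i && J j) ==> (k.+1 ^ 2 * l i n <= u j n)%N].
    have [/andP[Ii Jj]|_] := boolP (I i && J j); last exact: filterE.
    exact: (LU _ _ (Il _ Ii) (Ju _ Jj)).
  apply: filterS (filter_forall _ (fun i => filter_forall _ (goodij i))) => n h.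
  by do 2!apply/forallP => ?; exact: h.
(* The number of requirements met at [n], capped by [n] so that the maximum exists; it tends to
   infinity because each [good n k] holds for large [n]. *)
pose kk n := (\max_(k < n.+1 | good n k) k)%N.
have kk_good n k : (k <= n)%N -> good n k -> (k <= kk n)%N /\ good n (kk n).
  move=> kn gd; split.
    exact: (@leq_bigmax_cond _ _ (fun k : 'I_n.+1 => k : nat)
      (Ordinal (kn : (k < n.+1)%N))).
  have [|i gi ki] := @eq_bigmax_cond _ [pred k : 'I_n.+1 | good n k] (fun k => k : nat).
    by apply/card_gt0P; exists (Ordinal (kn : (k < n.+1)%N)).
  by rewrite /kk ki.
have kk_near K : \oo [set n | (K <= kk n)%N /\ good n (kk n)].
  apply: filterS2 (good_near K) (_ : \oo [set n | K <= n]%N) => [n gd Kn|].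
    exact: kk_good.
  by exists K.
exists (fun n => (kk n).+1 * \max_(i < (kk n).+1 | I i) l i n)%N; split.
  move=> _ /Ll[i Ii <-] k; apply: filterS (kk_near (maxn k i)) => n [].
  rewrite geq_max => /andP[kn i_n] _ /=; apply: leq_mul; first exact: leqW.
  exact: (@leq_bigmax_cond _ (fun i : 'I_(kk n).+1 => I i)
    (fun i : 'I_(kk n).+1 => l i n) (Ordinal (i_n : (i < (kk n).+1)%N))).
move=> _ /Uu[j Jj <-] k; apply: filterS (kk_near (maxn k j)) => n [].
rewrite geq_max => /andP[kn jn] /goodP gd /=.
apply: (@leq_trans ((kk n).+1 ^ 2 * \max_(i < (kk n).+1 | I i) l i n)).
  by rewrite mulnA leq_mul2r -mulnn leq_mul2r leqW ?orbT.
rewrite mulnC -leq_divRL ?expn_gt0//; apply/bigmax_leqP => i Ii.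
rewrite leq_divRL ?expn_gt0// mulnC; apply: gd => //; exact: leq_ord.
Qed.

Section Tree.
Variables (T : choiceType) (R : rel T).
Hypothesis Rwo : well_order R.
Variable base : nat -> nat.

(** A branch of the binary tree is coded by the set [B] of levels at which it turns upwards; [h]
    records the nodes already built, and [c] is a candidate for the next one. *)
Definition separating (B : set T) (h : set (T * (nat -> nat))) := [set c |
  [/\ dominated base c,
      forall p, h p -> B p.1 -> dominated p.2 c &
      forall p, h p -> ~ B p.1 -> dominated c p.2]].

Lemma separating_tree : exists tree : set T -> T -> nat -> nat, forall B x,
  tree B x = xget base (separating B [set p | strict R p.1 x /\ p.2 = tree B p.1]).
Proof.
have /boolp.choice[tree treeE] := fun B => wf_rec
  (fun _ h => xget base (separating B h)) (strict_wf Rwo).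
by exists tree.
Qed.

Variable tree : set T -> T -> nat -> nat.
Hypothesis treeE : forall B x,
  tree B x = xget base (separating B [set p | strict R p.1 x /\ p.2 = tree B p.1]).

(** The node at level [x] is chosen from the turns below [x] only, so branches share their nodes up
    to and including the first level where they differ. *)
Lemma tree_local B B' x : (forall y, strict R y x -> (B y <-> B' y)) ->
  tree B x = tree B' x.
Proof.
elim/(well_founded_ind (strict_wf Rwo)): x => x IH BB'.
have tE y : strict R y x -> tree B y = tree B' y.
  by move=> yx; apply: IH => // z /(strict_trans Rwo)/(_ yx)/BB'.
rewrite [LHS]treeE [RHS]treeE; congr (xget _ _).
apply/seteqP; split=> c [bc Lc Uc]; split=> // -[y q] /= [yx ->] By.
- by apply: (Lc (y, _)); [split; rewrite //= tE|apply/BB'].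
- by apply: (Uc (y, _)); [split; rewrite //= tE|move/(BB' _ yx)].
- by apply: (Lc (y, _)); [split; rewrite //= tE|apply/BB'].
- by apply: (Uc (y, _)); [split; rewrite //= tE|move/(BB' _ yx)].
Qed.

(** By induction [base] and the earlier nodes with level in [B] are dominated by the earlier nodes
    with level outside [B]: of two levels, the later was placed on the correct side of the earlier.
    There are countably many, so interpolation gives a candidate and [xget] does not fall back on
    its default. *)
Lemma treeP B x : countable_initial R x ->
  [/\ dominated base (tree B x),
      forall y, strict R y x -> B y -> dominated (tree B y) (tree B x) &
      forall y, strict R y x -> ~ B y -> dominated (tree B x) (tree B y)].
Proof.
elim/(well_founded_ind (strict_wf Rwo)): x => x IH Sx.
have {}IH y (yx : strict R y x) := IH y yx (countable_initial_down Rwo Sx yx).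
suff : (separating B [set p | strict R p.1 x /\ p.2 = tree B p.1]) (tree B x).
  move=> [bx Lx Ux]; split=> // y yx By; first exact: (Lx (y, tree B y)).
  exact: (Ux (y, tree B y)).
rewrite [tree B x]treeE; apply: xgetPex.
have cI (A : set T) : countable (tree B @` [set y | strict R y x /\ A y]).
  apply: sub_countable Sx; apply: (card_le_trans (card_image_le _ _)).
  by apply: subset_card_le => y [].
have [||l u|c [Lc Uc]] := @dominated_interpolation
  ([set base] `|` tree B @` [set y | strict R y x /\ B y])
  (tree B @` [set y | strict R y x /\ ~ B y]).
- rewrite -bigcup2E; apply: bigcup_countable => // -[|[|i]] _ /=; last by [].
    exact: countable1.
  exact: cI.
- exact: cI.
- move=> [->|[y [yx By] <-]] [z [zx Bz] <-]; first by have [] := IH z zx.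
  case: (strict_total Rwo y z) => [e|yz|zy]; first by rewrite e in By.
    by have [_ h _] := IH z zx; exact: h.
  by have [_ _ h] := IH y yx; exact: h.
exists c; split; first by apply: Lc; left.
  by move=> [y q] /= [yx ->] By; apply: Lc; right; exists y.
by move=> [y q] /= [yx ->] By; apply: Uc; exists y.
Qed.

(** Both branches have the same node at [x]. Seen from [B'], which turns downwards there, every node
    where [B'] turns upwards lies below it, whether earlier or later. *)
Lemma tree_separated B B' x y : countable_initial R x -> countable_initial R y ->
  (forall z, strict R z x -> (B z <-> B' z)) ->
  B x -> ~ B' x -> B' y -> dominated (tree B' y) (tree B x).
Proof.
move=> Sx Sy BB' Bx nB'x B'y; rewrite (tree_local BB').
case: (strict_total Rwo x y) => [e|xy|yx]; first by rewrite e in nB'x.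
  by have [_ _ h] := treeP B' Sy; exact: h.
by have [_ h _] := treeP B' Sx; exact: h.
Qed.

End Tree.

(** * Ideals, localizations and quotients *)

Section IdealTheory.
Variable A : comPzRingType.
Implicit Types I J P Q : set A.

Lemma is_idealN I x : is_ideal I -> I x -> I (- x).
Proof. by move=> [_ _ IM] Ix; rewrite -mulN1r; exact: IM. Qed.

Lemma is_idealB I x y : is_ideal I -> I x -> I y -> I (x - y).
Proof. by move=> Ii Ix Iy; case: (Ii) => _ ID _; apply: ID (is_idealN Ii Iy). Qed.

Lemma is_idealMr I x a : is_ideal I -> I x -> I (x * a).
Proof. by move=> [_ _ IM] Ix; rewrite mulrC; exact: IM. Qed.

Lemma ideal_sum I (T : Type) (s : seq T) (p : pred T) (F : T -> A) : is_ideal I ->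
  (forall i, p i -> I (F i)) -> I (\sum_(i <- s | p i) F i).
Proof. by move=> [I0 ID _] IF; elim/big_rec: _ => // i x pi Ix; apply: ID (IF _ pi) _. Qed.

Lemma ideal_eqT I : is_ideal I -> (I = setT <-> I 1).
Proof.
move=> Ii; split=> [->//|I1]; apply/seteqP; split=> // x _.
by rewrite -[x]mulr1; case: Ii => _ _; apply.
Qed.

Lemma ideal_gen_sub I J : is_ideal J -> I `<=` J -> ideal_gen I `<=` J.
Proof. by move=> Ji IJ x; apply; split. Qed.

Lemma sub_ideal_gen I : I `<=` ideal_gen I.
Proof. by move=> x Ix J [_]; exact. Qed.

Lemma ideal_gen1P (a x : A) : ideal_gen [set a] x <-> exists b, x = b * a.
Proof.
have Ji : is_ideal [set y | exists b, y = b * a].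
  split=> [|_ _ [b ->] [c ->]|c _ [b ->]]; first by exists 0; rewrite mul0r.
    by exists (b + c); rewrite mulrDl.
  by exists (c * b); rewrite mulrA.
split=> [|[b ->]].
  by apply: (ideal_gen_sub Ji) => _ ->; exists 1; rewrite mul1r.
have [_ _ h] := ideal_gen_ideal [set a]; apply: h; exact: sub_ideal_gen.
Qed.

Lemma prime_not1 P : is_prime P -> ~ P 1.
Proof. by move=> [Pi PT _] /(ideal_eqT Pi). Qed.

Lemma prime_notM P x y : is_prime P -> ~ P x -> ~ P y -> ~ P (x * y).
Proof. by move=> [_ _ PP] nx ny /PP[]. Qed.

Lemma prime_notX P x n : is_prime P -> ~ P x -> ~ P (x ^+ n).
Proof.
move=> PP nx; elim: n => [|n IH]; first by rewrite expr0; exact: prime_not1.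
by rewrite exprS; exact: prime_notM.
Qed.

Lemma prime_not_prod P (T : eqType) (s : seq T) (F : T -> A) : is_prime P ->
  (forall i, i \in s -> ~ P (F i)) -> ~ P (\prod_(i <- s) F i).
Proof.
move=> PP PF; rewrite big_seq; elim/big_rec: _ => [|i x si]; first exact: prime_not1.
by apply: prime_notM => //; exact: PF.
Qed.

Lemma maximal_bezout P x : is_maximal P -> ~ P x -> exists y, P (1 - y * x).
Proof.
move=> [Pi PT Pm] nPx; pose J := [set z | exists y, P (z - y * x)].
have [P0 PD PM] := Pi.
have Ji : is_ideal J.
  split=> [|z w [a za] [b wb]|c z [a za]].
  - by exists 0; rewrite mul0r subrr.
  - exists (a + b); have := PD _ _ za wb.
    by rewrite (_ : _ + _ = z + w - (a + b) * x) //; ring.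
  - exists (c * a); have := PM c _ za.
    by rewrite (_ : _ * _ = c * z - c * a * x) //; ring.
have [|JP|JT] := Pm J Ji.
- by move=> z Pz; exists 0; rewrite mul0r subr0.
- by case: nPx; rewrite -JP; exists 1; rewrite mul1r subrr.
- by have : J 1 by rewrite JT.
Qed.

Lemma maximal_prime P : is_maximal P -> is_prime P.
Proof.
move=> Pm; have [Pi PT _] := Pm; split=> // x y Pxy.
apply: contrapT => /not_orP[/(maximal_bezout Pm)[z Pz]]; apply.
have [_ PD PM] := Pi.
rewrite (_ : y = y * (1 - z * x) + z * (x * y)); last by ring.
by apply: PD; apply: PM.
Qed.

Lemma maximal_eq P Q : is_maximal P -> is_ideal Q -> ~ Q 1 -> P `<=` Q -> Q = P.
Proof. by move=> [_ _ Pm] Qi nQ1 /(Pm _ Qi)[//|/(ideal_eqT Qi)]. Qed.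

Lemma maximal_exists I : is_ideal I -> ~ I 1 -> exists2 P, is_maximal P & I `<=` P.
Proof.
move=> Ii I1; pose F := [set J | J = set0 \/ [/\ is_ideal J, I `<=` J & ~ J 1]].
have [|P [FP Pmax]] := @Zorn_bigcup A F.
  move=> C CF Ct; have [[J0 CJ0 J0n]|h] :=
    pselect (exists2 J, C J & J !=set0); last first.
    left; rewrite -subset0 => x [J CJ Jx]; apply: h; exists J => //.
    by exists x.
  have good J x : C J -> J x -> [/\ is_ideal J, I `<=` J & ~ J 1].
    by move=> /CF[->//|].
  have [x0 J0x0] := J0n; have [J0i IJ0 _] := good _ _ CJ0 J0x0.
  right; split; last by move=> [J CJ J1]; have [_ _] := good _ _ CJ J1; exact.
    split=> [|x y [J CJ Jx] [K CK Ky]|a x [J CJ Jx]].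
    - by exists J0 => //; case: J0i.
    - have [[_ JD _] _ _] := good _ _ CJ Jx; have [[_ KD _] _ _] := good _ _ CK Ky.
      have [JK|KJ] := Ct _ _ CJ CK; first by exists K => //; apply: KD => //; exact: JK.
      by exists J => //; apply: JD => //; exact: KJ.
    - by have [[_ _ JM] _ _] := good _ _ CJ Jx; exists J => //; exact: JM.
  by move=> x Ix; exists J0 => //; exact: IJ0.
case: FP => [P0|[Pi IP P1]].
  case: (Pmax I); last by right; split.
  rewrite P0; split=> [|h]; last by have [/h] := Ii.
  exact: sub0set.
exists P => //; split=> [//||J Ji PJ]; first by move/(ideal_eqT Pi).
have [J1|J1] := pselect (J 1); first by right; exact/ideal_eqT.
left; apply/seteqP; split=> //; apply: contrapT => nJP.
by apply: (Pmax J); [split|right; split=> //; exact: subset_trans PJ].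
Qed.

End IdealTheory.

(** * Primes of a localization and heights *)

Section Localization.
Variables (A : comPzRingType) (Q : set A).
Hypothesis Qprime : is_prime Q.
Implicit Types P : set A.
Local Notation AQ := (localization Q).

Lemma mult_gen_compl x : mult_gen (~` Q) x <-> ~ Q x.
Proof.
split=> [h|Qx]; last by move=> J [_]; exact.
apply: (h (~` Q)); split=> //; split=> [|y z]; first exact: prime_not1.
exact: prime_notM.
Qed.

Lemma denom_notin (a : pre_frac (~` Q)) : ~ Q (denom a).
Proof. by have /mult_gen_compl := denomP a. Qed.

Lemma frac_mapM (x y : A) :
  frac_map (~` Q) (x * y) = frac_map (~` Q) x * frac_map (~` Q) y :> AQ.
Proof.
symmetry; apply: (etrans (to_fracM _ _)); apply: to_frac_eq.
by rewrite !numer_denomE; ring.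
Qed.

Lemma frac_mapD (x y : A) :
  frac_map (~` Q) (x + y) = frac_map (~` Q) x + frac_map (~` Q) y :> AQ.
Proof.
symmetry; apply: (etrans (to_fracD _ _)); apply: to_frac_eq.
by rewrite !numer_denomE; ring.
Qed.

Lemma frac_map_numer (a : pre_frac (~` Q)) :
  frac_map (~` Q) (numer a) = frac_map (~` Q) (denom a) * to_frac a :> AQ.
Proof.
symmetry; apply: (etrans (to_fracM _ _)); apply: to_frac_eq.
by rewrite !numer_denomE; ring.
Qed.

Lemma frac_map_unit x : ~ Q x -> exists y : AQ, y * frac_map (~` Q) x = 1.
Proof.
move=> nx; have Sx : mult_gen (~` Q) x by exact/mult_gen_compl.
exists (to_frac (mk_pre_frac 1 Sx)).
apply: (etrans (to_fracM _ _)); apply: to_frac_eq.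
by rewrite !numer_denomE /numer /denom /=; ring.
Qed.

Lemma frac_map_eq x y : frac_map (~` Q) x = frac_map (~` Q) y <->
  exists2 u, ~ Q u & u * x = u * y.
Proof.
split=> [/to_fracP[u Su]|[u Su e]].
  by rewrite !numer_denomE !mulr1 => e; exists u => //; exact/mult_gen_compl.
by apply/to_fracP; exists u; rewrite ?numer_denomE ?mulr1//; exact/mult_gen_compl.
Qed.

Definition loc_ideal P : set AQ := [set x | exists2 a, P (numer a) & x = to_frac a].

Definition loc_contr (J : set AQ) : set A := [set x | J (frac_map (~` Q) x)].

Lemma loc_idealP P a : is_prime P -> P `<=` Q ->
  loc_ideal P (to_frac a) <-> P (numer a).
Proof.
move=> [Pi PT PP] PQ; have [_ _ PM] := Pi.
split=> [[b Pb /to_fracP[u /mult_gen_compl Su e]]|Pa]; last by exists a.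
have : P (u * (numer a * denom b)) by rewrite e; apply: PM; exact: is_idealMr.
by move=> /PP[/PQ//|/PP[//|/PQ/denom_notin]].
Qed.

Lemma loc_ideal_prime P : is_prime P -> P `<=` Q -> is_prime (loc_ideal P).
Proof.
move=> Pp PQ; have [[P0 PD PM] PT PP] := Pp; have Pi : is_ideal P by [].
split; [split|..].
- by exists (pre_cst (~` Q) 0).
- move=> _ _ [a Pa ->] [b Pb ->]; exists (pre_add a b); last exact: to_fracD.
  by rewrite numer_denomE; apply: PD; exact: is_idealMr.
- move=> x _ [b Pb ->]; rewrite -[x]frac_reprK.
  by exists (pre_mul (frac_repr x) b); [rewrite numer_denomE; exact: PM|exact: to_fracM].
- move=> e; have : loc_ideal P (frac_map (~` Q) 1) by rewrite e.
  by move=> /loc_idealP-/(_ Pp PQ)/prime_not1; exact.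
- move=> x y; rewrite -[x]frac_reprK -[y]frac_reprK.
  set a := frac_repr x; set b := frac_repr y.
  have -> : (to_frac a : AQ) * to_frac b = to_frac (pre_mul a b) by exact: to_fracM.
  by rewrite !loc_idealP // numer_denomE => /PP.
Qed.

Lemma loc_idealK P : is_prime P -> P `<=` Q -> loc_contr (loc_ideal P) = P.
Proof.
by move=> Pp PQ; apply/seteqP; split=> x; rewrite /loc_contr /= loc_idealP.
Qed.

Lemma loc_contrP J a : is_ideal J -> J (to_frac a) <-> loc_contr J (numer a).
Proof.
move=> Ji; have [_ _ JM] := Ji; rewrite /loc_contr /= frac_map_numer.
split=> [|h]; first exact: JM.
have [y ye] := frac_map_unit (@denom_notin a).
by rewrite -[to_frac a](mul1r (to_frac a : AQ)) -ye -mulrA; exact: JM.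
Qed.

Lemma loc_contr_inj J K : is_ideal J -> is_ideal K -> loc_contr J = loc_contr K -> J = K.
Proof.
move=> Ji Ki e; apply/seteqP; split=> x; rewrite -[x]frac_reprK.
  by rewrite !loc_contrP // e.
by rewrite !loc_contrP // e.
Qed.

Lemma loc_contr_prime J : is_prime J -> is_prime (loc_contr J).
Proof.
move=> Jp; have [[J0 JD JM] JT JP] := Jp; split; [split|..].
- exact: J0.
- by move=> x y Jx Jy; rewrite /loc_contr /= frac_mapD; exact: JD.
- by move=> a x Jx; rewrite /loc_contr /= frac_mapM; exact: JM.
- by move=> e; apply: (prime_not1 Jp); have : loc_contr J 1 by rewrite e.
- by move=> x y; rewrite /loc_contr /= frac_mapM => /JP.
Qed.

Lemma loc_contr_sub J : is_prime J -> loc_contr J `<=` Q.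
Proof.
move=> Jp x Jx; apply: contrapT => /frac_map_unit[y ye].
by apply: (prime_not1 Jp); rewrite -ye; have [[_ _ JM] _ _] := Jp; exact: JM.
Qed.

(** Extension and contraction preserve inclusions and identify no two of the primes involved, so
    chains pass in both directions with their cardinality. *)
Lemma height_geP U (S : set U) : height_ge Q S <->
  exists C : set (set A), [/\ prime_chain C, forall P, C P -> P `<=` Q &
    exists2 P, C P & S #<= C `\ P].
Proof.
split=> [[C [[[P CP] Cp Ct] [P0 CP0 SC]]]|[C [[[P CP] Cp Ct] CQ [P0 CP0 SC]]]].
  exists [set loc_contr J | J in C]; split; first split.
  - by exists (loc_contr P), P.
  - by move=> _ [J CJ <-]; exact/loc_contr_prime/Cp.
  - move=> _ _ [J CJ <-] [K CK <-].
    by have [h|h] := Ct J K CJ CK; [left|right] => x; exact: h.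
  - by move=> _ [J CJ <-]; exact/loc_contr_sub/Cp.
  exists (loc_contr P0); first by exists P0.
  apply: (card_le_trans SC); apply: (@card_le_inj _ _ _ _ loc_contr).
    move=> J [CJ JP]; split; first by exists J.
    by move=> /= e; apply: JP; apply: loc_contr_inj e; [case: (Cp J CJ)|case: (Cp P0 CP0)].
  move=> J K [CJ _] [CK _]; apply: loc_contr_inj; first by case: (Cp J CJ).
  by case: (Cp K CK).
exists [set loc_ideal J | J in C]; split; first split.
- by exists (loc_ideal P), P.
- by move=> _ [J CJ <-]; apply: loc_ideal_prime; [exact: Cp|exact: CQ].
- move=> _ _ [J CJ <-] [K CK <-].
  by have [h|h] := Ct J K CJ CK; [left|right] => _ [a Ja ->]; exists a => //; exact: h.
exists (loc_ideal P0); first by exists P0.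
have inj J K : C J -> C K -> loc_ideal J = loc_ideal K -> J = K.
  move=> CJ CK e; rewrite -(loc_idealK (Cp J CJ) (CQ J CJ)) e.
  by rewrite loc_idealK //; [exact: Cp|exact: CQ].
apply: (card_le_trans SC); apply: (@card_le_inj _ _ _ _ loc_ideal).
  move=> J [CJ JP]; split; first by exists J.
  by move=> /= e; apply: JP; exact: inj e.
by move=> J K [CJ _] [CK _]; exact: inj.
Qed.

End Localization.

(** * Primes of a quotient ring *)

Section QuotientPrimes.
Variables (A : comPzRingType) (I : set A).
Implicit Types P Q : set A.

Lemma quot_map0 : quot_map I 0 = 0.
Proof. by rewrite /quot_map raddf0. Qed.

Lemma quot_image P x : is_ideal P -> I `<=` P ->
  (@quot_map A I @` P) (quot_map I x) <-> P x.
Proof.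
move=> Pi IP; split=> [[y Py /quot_mapP yx]|]; last by exists x.
rewrite -[x](subKr y); apply: (is_idealB Pi Py).
exact: (ideal_gen_sub Pi IP).
Qed.

Lemma quot_image_prime P : is_prime P -> I `<=` P -> is_prime (@quot_map A I @` P).
Proof.
move=> Pp IP; have [[P0 PD PM] PT PP] := Pp; have Pi : is_ideal P by [].
split; [split|..].
- by exists 0; rewrite ?quot_map0.
- by move=> _ _ [x Px <-] [y Py <-]; exists (x + y); [exact: PD|exact: quot_mapD].
- move=> a _ [y Py <-]; rewrite -[a]quot_reprK.
  by exists (quot_repr a * y); [exact: PM|exact: quot_mapM].
- move=> e; have : (@quot_map A I @` P) (quot_map I 1) by rewrite e.
  by move=> /(quot_image _ Pi IP); exact: prime_not1.
- move=> x y; rewrite -[x]quot_reprK -[y]quot_reprK.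
  have -> : quot_map I (quot_repr x) * quot_map I (quot_repr y) =
    quot_map I (quot_repr x * quot_repr y) by rewrite quot_mapM.
  by rewrite !(quot_image _ Pi IP) => /PP.
Qed.

(** Primes containing [I] have prime images and can be recovered from them, so the chain keeps its
    cardinality in the quotient. *)
Lemma height_ge_quot Q U (S : set U) (C : set (set A)) : is_prime Q -> prime_chain C ->
  (forall P, C P -> I `<=` P /\ P `<=` Q) -> (exists2 P, C P & S #<= C `\ P) ->
  height_ge (@quot_map A I @` Q) S.
Proof.
move=> Qp [[P CP] Cp Ct] CQ [P0 CP0 SC].
have IQ : I `<=` Q by have [IP PQ] := CQ P CP; exact: subset_trans PQ.
have inj J K : C J -> C K -> quot_map I @` J = quot_map I @` K -> J = K.
  move=> CJ CK e; have [[Ji _ _] [Ki _ _]] := (Cp J CJ, Cp K CK).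
  have [[IJ _] [IK _]] := (CQ J CJ, CQ K CK).
  by apply/seteqP; split=> x; rewrite -(quot_image x Ji IJ) -(quot_image x Ki IK) e.
apply/(height_geP (quot_image_prime Qp IQ)).
exists [set quot_map I @` J | J in C]; split; first split.
- by exists (quot_map I @` P), P.
- by move=> _ [J CJ <-]; apply: quot_image_prime; [exact: Cp|case: (CQ J CJ)].
- move=> _ _ [J CJ <-] [K CK <-].
  by have [h|h] := Ct J K CJ CK; [left|right] => _ [x Jx <-]; exists x => //; exact: h.
- by move=> _ [J CJ <-] _ [x Jx <-]; exists x => //; have [_] := CQ J CJ; exact.
exists (quot_map I @` P0); first by exists P0.
apply: (card_le_trans SC); apply: (@card_le_inj _ _ _ _ (fun J => quot_map I @` J)).
  move=> J [CJ JP]; split; first by exists J.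
  by move=> /= e; apply: JP; exact: inj e.
by move=> J K [CJ _] [CK _]; exact: inj.
Qed.

End QuotientPrimes.

(** * Chains of primes in power series rings *)

Section SeriesIdeals.
Variable A : comPzRingType.
Implicit Types (N I : set A) (f g : power_series A).

(** The order of [f] modulo [N] is at least [k]. *)
Definition vanishes N k f := forall i, (i < k)%N -> N (coefs f i).

Lemma vanishesW N k l f : (l <= k)%N -> vanishes N k f -> vanishes N l f.
Proof. by move=> lk h i il; apply: h; exact: leq_trans lk. Qed.

Lemma not_vanishes N k f : ~ vanishes N k f ->
  exists i, [/\ (i < k)%N, ~ N (coefs f i) & vanishes N i f].
Proof.
move=> /existsNP[i0 /not_implyP[i0k Ni0]].
have ex : exists i, `[< ~ N (coefs f i) >] by exists i0; apply/asboolP.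
case: (ex_minnP ex) => i /asboolP Ni min_i; exists i; split=> //.
  by apply: leq_ltn_trans i0k; apply: min_i; apply/asboolP.
move=> j ji; apply: contrapT => nj; move: ji; rewrite ltnNge.
by rewrite min_i //; apply/asboolP.
Qed.

(** If [i] and [j] are the orders of [f] and [g], the coefficient of index [i + j] of the product
    is, modulo [N], the product of the two lowest coefficients: orders modulo a prime add. *)
Lemma vanishes_mul N k l f g : is_prime N ->
  ~ vanishes N k f -> ~ vanishes N l g -> ~ vanishes N (k + l) (f * g).
Proof.
move=> Np /not_vanishes[i [ik Nfi fi]] /not_vanishes[j [jl Ngj gj]] fg.
have [Ni _ NP] := Np; have ij : (i < (i + j).+1)%N by rewrite ltnS leq_addr.
have : N (coefs (f * g) (i + j)%N).
  apply: fg; rewrite -addnS; apply: leq_add => //; exact: ltnW.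
rewrite coef_ps_mul (bigD1 (Ordinal ij)) //= addKn => h.
apply: (prime_notM Np Nfi Ngj); rewrite -(addrK (\sum_(l < (i + j).+1 | l != Ordinal ij)
   coefs f l * coefs g (i + j - l)) (coefs f i * coefs g j)).
apply: is_idealB => //; apply: ideal_sum => //= m mi.
have [mlt|] := ltnP m i; first by apply: is_idealMr => //; exact: fi.
rewrite leq_eqVlt => /orP[/eqP e|im].
  by case/eqP: mi; apply: val_inj.
case: Ni => _ _ NM; apply/NM/gj; rewrite ltn_subLR; last exact: leq_ord.
by rewrite ltn_add2r.
Qed.

Lemma coefs_in_ideal I : is_ideal I -> is_ideal (ps_coefs_in I).
Proof.
move=> Ii; have [I0 ID IM] := Ii; split=> [n|f g If Ig n|f g Ig n].
- by rewrite /= if_same.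
- exact: ID.
- by rewrite coef_ps_mul; apply: ideal_sum => // i _; apply: IM.
Qed.

Lemma coefs_in_prime I : is_prime I -> is_prime (ps_coefs_in I).
Proof.
move=> Ip; have [Ii _ _] := Ip; split; first exact: coefs_in_ideal.
  move=> e; have : ps_coefs_in I 1 by rewrite e.
  by move=> /(_ 0%N); exact: prime_not1.
have nv f : ~ ps_coefs_in I f -> exists k, ~ vanishes I k f.
  by move=> /existsNP[n nf]; exists n.+1 => /(_ n (ltnSn n)).
move=> f g fg; apply: contrapT => /not_orP[/nv[k fk] /nv[l gl]].
by apply: (vanishes_mul Ip fk gl) => i _; exact: fg.
Qed.

Lemma ps_ext_sub I (J : set (power_series A)) : is_ideal J ->
  (forall a, I a -> J (ps_cst a)) -> ps_ext I `<=` J.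
Proof. by move=> Ji IJ; apply: ideal_gen_sub => // _ [a Ia <-]; exact: IJ. Qed.

Lemma cst_coefs_in I a : is_ideal I -> I a -> ps_coefs_in I (ps_cst a).
Proof. by move=> [I0 _ _] Ia [|n]. Qed.

End SeriesIdeals.

(** * Primes cut out by growth rates *)

Section CutIdeals.
Variables (A : comPzRingType) (M : set A) (N : nat -> set A) (e : nat -> A).
Hypotheses (Mprime : is_prime M) (Nprime : forall n, is_prime (N n)).
Hypotheses (MN : forall a, M a -> \oo [set n | N n a]).
Hypotheses (MNc : forall a, ~ M a -> \oo [set n | ~ N n a]).
Hypotheses (Me : forall n, M (e n)) (Nne : forall n, ~ N n (e n)).
Hypothesis Ne : forall m n, m <> n -> N m (e n).
Variable G : set_system nat.
Hypotheses (Gultra : UltraFilter G) (Goo : \oo `<=` G).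

(* The order of a series modulo [N n], taken modulo the ultrafilter, is a
   valuation with values in an ultrapower of the natural numbers; the cut ideals
   are given by its convex subgroups. *)
Definition cut_ideal (C : set (nat -> nat)) : set (power_series A) :=
  [set f | forall c k, C c -> G [set n | vanishes (N n) (k * c n) f]].

(** A set outside an ultrafilter has its complement inside, so two series outside the ideal have
    orders below [k * c n] and [k' * c' n] for all [n] in one set of the ultrafilter. Orders add,
    and a [c''] above [c] and [c'], with the factor [k + k'], excludes the product. *)
Lemma cut_ideal_prime (C : set (nat -> nat)) :
  (exists2 c, C c & forall n, (n < c n)%N) ->
  (forall c c', C c -> C c' -> exists c'', [/\ C c'',
     \oo [set n | (c n <= c'' n)%N] & \oo [set n | (c' n <= c'' n)%N]]) ->
  is_prime (cut_ideal C).
Proof.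
move=> [b Cb bP] Cdir; have Ni n : is_ideal (N n) by case: (Nprime n).
split; first split.
- move=> c k _; apply: filterE => n i _ /=.
  by rewrite if_same; case: (Ni n).
- move=> f g Cf Cg c k Cc; apply: filterS2 (Cf c k Cc) (Cg c k Cc) => n fn gn i ik.
  by have [_ ND _] := Ni n; apply: ND; [exact: fn|exact: gn].
- move=> f g Cg c k Cc; apply: filterS (Cg c k Cc) => n gn i ik.
  rewrite coef_ps_mul; apply: ideal_sum => // j _; have [_ _ NM] := Ni n.
  apply: NM; apply: gn; apply: leq_ltn_trans ik; exact: leq_subr.
- move=> h; have /(_ b 1%N Cb) : cut_ideal C 1 by rewrite h.
  move=> /filter_ex[n /(_ 0%N)]; rewrite mul1n (leq_ltn_trans _ (bP n)) //.
  by move=> /(_ isT); exact: prime_not1.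
- move=> f g fg; apply: contrapT => /not_orP[].
  have notin h : ~ cut_ideal C h ->
      exists c k, C c /\ G [set n | ~ vanishes (N n) (k * c n) h].
    move=> /existsNP[c /existsNP[k /not_implyP[Cc nG]]]; exists c, k; split=> //.
    by case: (in_ultra_setVsetC [set n | vanishes (N n) (k * c n) h] Gultra).
  move=> /notin[c [k [Cc Gf]]] /notin[c' [k' [Cc' Gg]]].
  have [c'' [Cc'' /Goo cc'' /Goo cc']] := Cdir c c' Cc Cc'.
  have GI (P Q : set nat) : G P -> G Q -> G (P `&` Q) by exact: filterI.
  have /filter_ex[n [[fn gn] [[cn cn'] /= fgn]]] := GI _ _ (GI _ _ Gf Gg)
    (GI _ _ (GI _ _ cc'' cc') (fg c'' (k + k')%N Cc'')).
  apply: (vanishes_mul (Nprime n) fn gn); apply: vanishesW fgn.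
  by rewrite mulnDl; apply: leq_add; rewrite leq_mul2l /= ?cn ?cn' orbT.
Qed.

(** A coefficient of index [i] outside [M] is outside [N n] for large [n], whereas an order above
    [n] puts it inside [N n] once [i <= n]. *)
Lemma cut_ideal_sub C : (exists2 c, C c & forall n, (n < c n)%N) ->
  cut_ideal C `<=` ps_coefs_in M.
Proof.
move=> [b Cb bP] f Cf i; apply: contrapT => /MNc nM.
have /Goo Gi : \oo [set n | i <= n]%N by exists i.
have GI (P Q : set nat) : G P -> G Q -> G (P `&` Q) by exact: filterI.
have /filter_ex[n [[/= nN ni] fn]] := GI _ _ (GI _ _ (Goo nM) Gi) (Cf b 1%N Cb).
by apply: nN; apply: fn; rewrite mul1n; exact: leq_ltn_trans (bP n).
Qed.

Lemma ps_ext_sub_cut C : is_ideal (cut_ideal C) -> ps_ext M `<=` cut_ideal C.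
Proof.
move=> Ci; apply: ps_ext_sub => // a Ma c k _; apply: filterS (Goo (MN Ma)).
by move=> n Na i _; apply: cst_coefs_in => //; case: (Nprime n).
Qed.

Lemma order_realized (c : nat -> nat) : \oo [set n | n < c n]%N ->
  exists f, ps_coefs_in M f /\
    forall n, vanishes (N n) (c n) f /\ ~ N n (coefs f (c n)).
Proof.
move=> [n0 _ cP].
(* An index [n] with [c n = i] satisfies [n < n0] or [n < i], so the bound [n0 + i] catches all of
   them. *)
exists (PowerSeries (fun i => \sum_(n < n0 + i | c n == i) e n)); split.
  by move=> i; apply: ideal_sum => [|n _]; [case: Mprime|exact: Me].
move=> n; have Ni : is_ideal (N n) by case: (Nprime n).
split=> [i ic|/=].
  apply: ideal_sum => // m /eqP cm; apply: Ne => nm.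
  by move: ic; rewrite nm cm ltnn.
have nlt : (n < n0 + c n)%N.
  have [nn|nn] := ltnP n n0; first exact: leq_trans (leq_addr _ _).
  by apply: leq_trans (leq_addl _ _); exact: cP.
rewrite (bigD1 (Ordinal nlt)) //= => h; apply: (@Nne n).
rewrite -(addrK (\sum_(i < n0 + c n | (c i == c n) && (i != Ordinal nlt)) e i) (e n)).
apply: is_idealB => //; apply: ideal_sum => // m /andP[_ mn]; apply: Ne => nm.
by case/eqP: mn; apply: val_inj.
Qed.

(** The order of [f] modulo [N n] is exactly [c n], which is positive for large [n] and so falls
    short of the [2 * c n] required for membership. *)
Lemma cut_ideal_witness (C : set (nat -> nat)) c : C c -> \oo [set n | n < c n]%N ->
  exists f, [/\ ps_coefs_in M f, forall n, vanishes (N n) (c n) f & ~ cut_ideal C f].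
Proof.
move=> Cc cP; have [f [Mf fc]] := order_realized cP; exists f; split=> // [n|Cf].
  by have [] := fc n.
have GI (P Q : set nat) : G P -> G Q -> G (P `&` Q) by exact: filterI.
have /filter_ex[n [/= nc fn]] := GI _ _ (Goo cP) (Cf c 2 Cc).
have [_] := fc n; apply; apply: fn; rewrite mul2n -addnn -[X in (X < _)%N]addn0.
by rewrite ltn_add2l; exact: leq_ltn_trans nc.
Qed.

Section Tree.
Variables (T : choiceType) (R : rel T).
Hypothesis Rwo : well_order R.
Local Notation S := (countable_initial R).
Local Notation base := succn.
Variable tree : set T -> T -> nat -> nat.
Hypothesis treeE : forall B x,
  tree B x = xget base (separating base B [set p | strict R p.1 x /\ p.2 = tree B p.1]).

(** Including [base] keeps the cut ideal inside M[[X]] even when [B] is empty. *)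
Definition branch (B : set T) := [set base] `|` tree B @` B.

Lemma branch_base B : exists2 c, branch B c & forall n, (n < c n)%N.
Proof. by exists base => //; left. Qed.

Lemma branch_directed B : B `<=` S -> forall c c', branch B c -> branch B c' ->
  exists c'', [/\ branch B c'',
     \oo [set n | (c n <= c'' n)%N] & \oo [set n | (c' n <= c'' n)%N]].
Proof.
move=> BS; have le1 a b : dominated a b -> \oo [set n | (a n <= b n)%N].
  by move=> /(_ 1%N); apply: filterS => n /=; rewrite mul1n.
have refl (a : nat -> nat) : \oo [set n | (a n <= a n)%N].
  by apply: filterE => n /=.
move=> c c' [->|[x Bx <-]] [->|[y By <-]].
- by exists base; split=> //; left.
- have [h _ _] := treeP Rwo treeE B (BS y By).
  by exists (tree B y); split=> //; [right; exists y|exact: le1].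
- have [h _ _] := treeP Rwo treeE B (BS x Bx).
  by exists (tree B x); split=> //; [right; exists x|exact: le1].
case: (strict_total Rwo x y) => [->|xy|yx].
- by exists (tree B y); split=> //; right; exists y.
- have [_ h _] := treeP Rwo treeE B (BS y By).
  by exists (tree B y); split=> //; [right; exists y|apply/le1/h].
- have [_ h _] := treeP Rwo treeE B (BS x Bx).
  by exists (tree B x); split=> //; [right; exists x|apply/le1/h].
Qed.

Lemma cut_branch_prime B : B `<=` S -> is_prime (cut_ideal (branch B)).
Proof.
by move=> BS; apply: cut_ideal_prime; [exact: branch_base|exact: branch_directed].
Qed.

(** At the first difference [x], the function [tree B x] dominates all of [branch B']. Order at
    least [tree B x] therefore suffices for the second ideal, and a series of exactly that order is
    not in the first. *)
Lemma cut_branch_lt (B B' : set T) x : B `<=` S -> B' `<=` S ->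
  (forall z, strict R z x -> (B z <-> B' z)) -> B x -> ~ B' x ->
  cut_ideal (branch B) `<` cut_ideal (branch B').
Proof.
move=> BS B'S BB' Bx nB'x; have Sx := BS x Bx.
have [bx _ _] := treeP Rwo treeE B Sx.
have domx c : branch B' c -> dominated c (tree B x).
  move=> [->//|[y B'y <-]].
  exact: (tree_separated Rwo treeE (x := x) Sx (B'S y B'y)).
have Bcx : branch B (tree B x) by right; exists x.
split=> [f Bf c k /domx/(_ k)/Goo h|].
  have Gf := Bf (tree B x) 1%N Bcx.
  by apply: filterS2 h Gf => n; rewrite /= mul1n; exact: vanishesW.
have xlt : \oo [set n | n < tree B x n]%N.
  by apply: filterS (bx 1%N) => n /=; rewrite mul1n.
have [f [_ fx nf]] := cut_ideal_witness Bcx xlt.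
move=> h; apply: nf; apply: h => c k /domx/(_ k)/Goo.
by apply: filterS => n /= ck; exact: vanishesW (fx n).
Qed.

Lemma cut_branch_lt_coefs B : cut_ideal (branch B) `<` ps_coefs_in M.
Proof.
split=> [|h]; first exact/cut_ideal_sub/branch_base.
have blt : \oo [set n | n < base n]%N by apply: filterE => n /=.
have [f [Mf _]] := @cut_ideal_witness (branch B) _ (or_introl erefl) blt.
by apply; exact: h.
Qed.

Lemma cut_branch_total (B B' : set T) : B `<=` S -> B' `<=` S -> B <> B' ->
  cut_ideal (branch B) `<` cut_ideal (branch B') \/
  cut_ideal (branch B') `<` cut_ideal (branch B).
Proof.
move=> BS B'S BB'.
have [|x xP xmin] := @strict_first _ _ Rwo (fun x => ~ (B x <-> B' x)).
  by apply: contrapT => /forallNP h; apply/BB'/predeqP => x; exact: contrapT.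
have {}xmin z : strict R z x -> (B z <-> B' z) by move/xmin/contrapT.
have [Bx|nBx] := pselect (B x); have [B'x|nB'x] := pselect (B' x).
- by case: xP.
- by left; exact: (@cut_branch_lt _ _ x).
- by right; apply: (@cut_branch_lt _ _ x) => // z /xmin[].
- by case: xP.
Qed.

Lemma prime_chain_branches : exists C : set (set (power_series A)),
  [/\ prime_chain C, forall P, C P -> ps_ext M `<=` P /\ P `<=` ps_coefs_in M &
      exists2 P, C P & [set B | B `<=` S] #<= C `\ P].
Proof.
pose br B := cut_ideal (branch B).
have Mi : is_ideal M by case: Mprime.
have extM : ps_ext M `<=` ps_coefs_in M.
  by apply: ps_ext_sub => [|a]; [exact: coefs_in_ideal|exact: cst_coefs_in].
(* M[[X]] is put on top as the one member that the length does not count; the cut ideals of all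
   branches remain. *)
exists ([set ps_coefs_in M] `|` br @` [set B | B `<=` S]); split; first split.
- by exists (ps_coefs_in M); left.
- move=> _ [->|[B BS <-]]; first exact: coefs_in_prime.
  exact: cut_branch_prime.
- have lt_M B : br B `<=` ps_coefs_in M by case: (cut_branch_lt_coefs B).
  move=> _ _ [->|[B BS <-]] [->|[B' B'S <-]].
  + by left.
  + by right; exact: lt_M.
  + by left; exact: lt_M.
  + have [->|/eqP BB'] := eqVneq B B'; first by left.
    by have [[]|[]] := cut_branch_total BS B'S BB'; [left|right].
- move=> _ [->|[B BS <-]]; first by split.
  split; last by case: (cut_branch_lt_coefs B).
  by apply: ps_ext_sub_cut; case: (cut_branch_prime BS).
exists (ps_coefs_in M); first by left.
apply: (@card_le_inj _ _ _ _ br).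
  move=> B BS; split; first by right; exists B.
  by move=> /= BM; have [_] := cut_branch_lt_coefs B; apply; rewrite -BM.
move=> B B' BS B'S brE; apply: contrapT => BB'.
by have [[_]|[_]] := cut_branch_total BS B'S BB'; apply; rewrite -/(br B) -/(br B') brE.
Qed.

End Tree.
End CutIdeals.

(** * Finitely generated maximal ideals *)

(** Writing [a] as [b n * p ^+ n] gives [b n = b n.+1 * p], so the ideals of the [b n] increase.
    Their union is principal, hence already generated by some [b N]; then [b N.+1] is a multiple of
    [b N], which makes [p] invertible unless [b N.+1] vanishes. *)
Lemma pid_krull (A : comPzRingType) (p a : A) : is_pid A -> (forall y, y * p <> 1) ->
  (forall n, exists b, a = b * p ^+ n) -> a = 0.
Proof.
move=> [[_ Adom] Apid] pU /boolp.choice[b ab]; apply: contrapT => a0.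
have dom (x y : A) : x * y = 0 -> x = 0 \/ y = 0.
  by move=> /Adom/orP[]/eqP; [left|right].
have b0 n : b n <> 0 by move=> bn; apply: a0; rewrite (ab n) bn mul0r.
have bS n : b n = b n.+1 * p.
  have [|/subr0_eq//|pn] := dom (b n - b n.+1 * p) (p ^+ n).
    by rewrite mulrBl -mulrA -exprS -!ab subrr.
  by case: a0; rewrite (ab n) pn mulr0.
have bD n k : exists c, b n = c * b (k + n)%N.
  elim: k => [|k [c bc]]; first by exists 1; rewrite mul1r.
  by exists (c * p); rewrite bc bS mulrAC mulrA.
have Ii : is_ideal [set x | exists n c, x = c * b n].
  split=> [|_ _ [n [c ->]] [m [d ->]]|c _ [n [d ->]]].
  - by exists 0%N, 0; rewrite mul0r.
  - have [u ->] := bD n m; have [v ->] := bD m n; exists (m + n)%N, (c * u + d * v).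
    by rewrite (addnC n m); ring.
  - by exists n, (c * d); rewrite mulrA.
have [g Ig] := Apid _ Ii.
have [N [c gE]] : [set x | exists n c, x = c * b n] g.
  by rewrite Ig; exact: sub_ideal_gen.
have : [set x | exists n c, x = c * b n] (b N.+1) by exists N.+1, 1; rewrite mul1r.
rewrite Ig => /ideal_gen1P[z bz].
have [|e|] := dom (1 - z * c * p) (b N.+1).
- by rewrite mulrBl mul1r {1}bz gE {1}(bS N); ring.
- by apply: (pU (z * c)); symmetry; exact: subr0_eq.
- by move=> /b0.
Qed.

(** With denominators cleared: [p] generates the maximal ideal of the localization at [M], and the
    ideals of its powers there meet only in zero. *)
Definition uniformizer (A : comPzRingType) (M : set A) (p : A) :=
  [/\ M p, p <> 0, forall m, M m -> exists t d, ~ M t /\ t * m = d * p &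
      forall a, (forall n, exists t d, ~ M t /\ t * a = d * p ^+ n) -> a = 0].

(** The nonzero maximal ideal of the localization is the extension of [M]; [p] is the numerator of a
    generator, the denominator being a unit. The last clause is [pid_krull]. *)
Lemma dvr_uniformizer (A : idomainType) (M : set A) : is_prime M ->
  is_dvr (localization M) -> exists p, uniformizer M p.
Proof.
move=> Mp [AMpid [J [[Jmax J0] _]]].
have Jp := maximal_prime Jmax; have [Ji _ _] := Jp.
have [Mi _ _] := Mp; have [M0 _ _] := Mi.
have JM : loc_ideal M = J.
  have Lp := loc_ideal_prime Mp Mp (fun x => id).
  apply: (maximal_eq Jmax); [by case: Lp|exact: prime_not1|].
  move=> x; rewrite -[x]frac_reprK (loc_contrP Mp _ Ji).
  by move=> /(loc_contr_sub Mp Jp) h; exists (frac_repr x).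
have [q Jq] := AMpid.2 J Ji.
have : J q by rewrite Jq; exact: sub_ideal_gen.
rewrite -JM => -[a Ma qa]; set p := numer a in Ma.
have f0 : frac_map (~` M) 0 = 0 :> localization M by [].
have pq := frac_map_numer a; rewrite -/p -qa in pq.
exists p; split=> //.
- move=> p0; apply: J0; rewrite Jq; apply/seteqP; split=> x.
    move=> /ideal_gen1P[b ->] /=.
    have [y ye] := frac_map_unit Mp (@denom_notin _ _ Mp a).
    by rewrite -[q]mul1r -ye -mulrA -pq p0 f0 !mulr0.
  by move=> ->; have [] := ideal_gen_ideal [set q].
- move=> m Mm; have : J (frac_map (~` M) m).
    by rewrite -JM; apply/(loc_idealP Mp).
  rewrite Jq => /ideal_gen1P[b mb]; have bE := frac_map_numer (frac_repr b).
  rewrite frac_reprK in bE; set b' := frac_repr b in bE.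
  have : frac_map (~` M) (p * numer b') = frac_map (~` M) (denom a * m * denom b').
    by rewrite !frac_mapM // pq bE mb; ring.
  move=> /(frac_map_eq Mp)[u Mu uE].
  exists (u * denom a * denom b'), (u * numer b'); split.
    by apply: (prime_notM Mp (prime_notM Mp Mu _)); exact: (denom_notin Mp).
  transitivity (u * (denom a * m * denom b')); first by ring.
  by rewrite -uE; ring.
- move=> x xp.
  have fX n : frac_map (~` M) (p ^+ n) = frac_map (~` M) p ^+ n.
    by elim: n => // n IH; rewrite !exprS frac_mapM // IH.
  have : frac_map (~` M) x = frac_map (~` M) 0.
    apply: (pid_krull (p := frac_map (~` M) p) AMpid) => [y yp|n].
      apply: (prime_not1 Jp); rewrite -yp; case: Ji => _ _; apply.
      by rewrite -JM; apply/(loc_idealP Mp).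
    have [t [d [Mt td]]] := xp n; have [y ye] := frac_map_unit Mp Mt.
    exists (y * frac_map (~` M) d); rewrite -fX -mulrA -frac_mapM // -td.
    by rewrite frac_mapM // mulrA ye mul1r.
  move=> /(frac_map_eq Mp)[u Mu /eqP]; rewrite mulr0 mulf_eq0 => /orP[]/eqP // u0.
  by case: Mu; rewrite u0.
Qed.

(** The product of the multipliers of finitely many generators serves all of [M] and stays outside
    the prime [M]. *)
Lemma fg_locally_principal (A : comPzRingType) (M : set A) p : is_prime M ->
  finitely_generated M -> (forall m, M m -> exists t d, ~ M t /\ t * m = d * p) ->
  exists2 t, ~ M t & forall m, M m -> exists d, t * m = d * p.
Proof.
move=> Mp [s Ms] Mloc.
have exT m : exists t, M m -> ~ M t /\ exists d, t * m = d * p.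
  have [/Mloc[t [d [Mt td]]]|nM] := pselect (M m); last by exists 0.
  by exists t => _; split=> //; exists d.
have [t tP] := boolp.choice exT.
have sM x : x \in s -> M x by move=> sx; rewrite Ms; exact: sub_ideal_gen.
exists (\prod_(x <- s) t x).
  by apply: prime_not_prod => // x /sM/tP[].
have Ii : is_ideal [set m | exists d, (\prod_(x <- s) t x) * m = d * p].
  split=> [|x y [a xa] [b yb]|c x [a xa]].
  - by exists 0; rewrite mulr0 mul0r.
  - by exists (a + b); rewrite mulrDr xa yb mulrDl.
  - by exists (c * a); rewrite mulrCA xa mulrA.
move=> m; rewrite {1}Ms; apply: (ideal_gen_sub Ii) => x /= sx.
have [_ [d td]] := tP x (sM x sx); rewrite (big_rem x sx) /=.
by exists (d * \prod_(y <- rem x s) t y); rewrite mulrAC td; ring.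
Qed.

(** * Invertible ideals *)

Section Invertible.
Variables (R : idomainType) (M : set R).

(** If 1 is a finite sum of products of elements of [M] and [J], multiplying by [m] expresses [m]
    through the factors from [M], since the products of [m] with the factors from [J] lie in [R]. *)
Lemma invertible_fg : is_ideal M -> invertible_ideal M -> finitely_generated M.
Proof.
move=> Mi [J _ MJ].
have [s [sMJ s1]] : fractional_mul (@tofrac R @` M) J 1.
  by rewrite MJ; exists 1; rewrite ?tofrac1.
have exg k : exists g, (@tofrac R @` M) k -> M g /\ tofrac g = k.
  by have [[g Mg gk]|h] := pselect ((@tofrac R @` M) k); [exists g|exists 0].
have [g gP] := boolp.choice exg.
have sM q : q \in s -> M (g q.1) /\ tofrac (g q.1) = q.1.
  by move=> /sMJ[/gP].
exists [seq g q.1 | q <- s]; apply/seteqP; split; last first.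
  apply: ideal_gen_sub => // x /mapP[q /sM[Mq _] ->]; exact: Mq.
move=> m Mm; have exd q : exists d, q \in s -> tofrac m * q.2 = tofrac d.
  have [/sMJ[_ Jq]|h] := boolP (q \in s); last by exists 0.
  have [d _ dq] : range (@tofrac R) (tofrac m * q.2).
    rewrite -MJ; exists [:: (tofrac m, q.2)]; split; last by rewrite big_seq1.
    by move=> _ /[1!inE]/eqP->; split=> //; exists m.
  by exists d.
have [d dP] := boolp.choice exd.
have -> : m = \sum_(q <- s) d q * g q.1.
  apply/eqP; rewrite -tofrac_eq rmorph_sum /= -[X in X == _]mulr1 s1 mulr_sumr.
  apply/eqP; rewrite [LHS]big_seq [RHS]big_seq; apply: eq_bigr => q sq.
  by rewrite rmorphM /= -dP // (sM q sq).2; ring.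
rewrite big_seq; apply: ideal_sum => [|q sq]; first exact: ideal_gen_ideal.
have [_ _] := ideal_gen_ideal [set` [seq g q.1 | q <- s]]; apply.
by apply: sub_ideal_gen => /=; apply/mapP; exists q.
Qed.

Lemma locally_principal_invertible p t : is_maximal M -> M p -> p <> 0 -> ~ M t ->
  (forall m, M m -> exists d, t * m = d * p) -> invertible_ideal M.
Proof.
move=> Mmax Mp p0 Mt tM; have [Mi _ _] := maximal_prime Mmax.
have [y My] := maximal_bezout Mmax Mt.
have unity (F : fieldType) (a b x q : F) : q != 0 ->
    (1 - b * x) * a + q * (a * b * (x / q)) = a by move=> q0; field.
have scale (F : fieldType) (a b x q : F) : q != 0 ->
    q * (a + b * (x / q)) = q * a + b * x by move=> q0; field.
have pF : tofrac p != 0 by rewrite tofrac_eq0; exact/eqP.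
exists [set z | exists a b, z = tofrac a + tofrac b * (tofrac t / tofrac p)].
  split.
  - by exists 0, 0; rewrite rmorph0 mul0r addr0.
  - move=> _ _ [a [b ->]] [c [d ->]]; exists (a + c), (b + d).
    by rewrite !rmorphD /=; ring.
  - move=> c _ [a [b ->]]; exists (c * a), (c * b); rewrite !rmorphM /=; ring.
  - exists p => // _ [a [b ->]]; exists (p * a + b * t) => //.
    by rewrite rmorphD !rmorphM /= scale.
apply/seteqP; split=> z.
  move=> [s [sP ->]]; rewrite big_seq; elim/big_rec: _ => [|q x sq [c _ <-]].
    by exists 0; rewrite ?rmorph0.
  have [[m Mm <-] [a [b ->]]] := sP q sq; have [d td] := tM m Mm.
  exists (m * a + b * d + c) => //; rewrite !rmorphD !rmorphM /=; congr (_ + _).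
  rewrite mulrDr; congr (_ + _).
  transitivity (tofrac b * (tofrac (t * m) / tofrac p)); last by rewrite rmorphM /=; ring.
  by rewrite td rmorphM /= mulfK.
(* Both [1 - y * t] and [p] lie in [M], and c = (1 - y t) c + p (c y t / p). *)
move=> [c _ <-]; exists [:: (tofrac (1 - y * t), tofrac c);
    (tofrac p, tofrac (c * y) * (tofrac t / tofrac p))]; split.
  move=> q; rewrite !inE => /orP[]/eqP-> /=; split.
  - by exists (1 - y * t).
  - by exists c, 0; rewrite rmorph0 mul0r addr0.
  - by exists p.
  - by exists 0, (c * y); rewrite rmorph0 add0r.
rewrite big_cons big_seq1 /= rmorphB !rmorphM rmorph1 /=.
by rewrite unity.
Qed.

End Invertible.

Lemma coef_cstM (A : comPzRingType) (a : A) f n : coefs (ps_cst a * f) n = a * coefs f n.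
Proof.
by rewrite coef_ps_mul big_ord_recl /= subn0 big1 ?addr0 // => i _; rewrite mul0r.
Qed.

(** * Height one for power series over a locally principal ideal *)

Section HeightOne.
Variables (A : idomainType) (M : set A) (p t : A).
Hypotheses (Mprime : is_prime M) (punif : uniformizer M p) (Mt : ~ M t).
Hypothesis tM : forall m, M m -> exists d, t * m = d * p.

Lemma coefs_in_div f : ps_coefs_in M f -> exists g, ps_cst t * f = ps_cst p * g.
Proof.
move=> Mf; have [d dP] := boolp.choice (fun n => tM (Mf n)).
by exists (PowerSeries d); apply: psP => n; rewrite !coef_cstM dP mulrC.
Qed.

(** For [f] in M[[X]], t f = p g, and [t] is not in [P]. If [p] is in [P], so is [f]. Otherwise [f]
    in [P] forces [g] in [P], the division can be repeated for ever, and the last clause of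
    [uniformizer] kills every coefficient. *)
Lemma primes_below_coefs_in P : is_prime P -> P `<=` ps_coefs_in M ->
  P = ps_coefs_in [set 0] \/ P = ps_coefs_in M.
Proof.
move=> Pp PM; have [[P0 _ PMl] _ PP] := Pp; have Pi : is_ideal P by case: Pp.
have nPt : ~ P (ps_cst t) by move=> /PM/(_ 0%N).
have [Pcp|nPp] := pselect (P (ps_cst p)); [right|left]; apply/seteqP; split=> f.
- exact: PM.
- move=> /coefs_in_div[g fg]; have : P (ps_cst t * f).
    by rewrite fg; exact: is_idealMr.
  by case/PP.
- move=> Pf i /=; have [_ _ _] := punif; apply => n.
  suff [g _ fg] : exists2 g, P g & forall j, t ^+ n * coefs f j = coefs g j * p ^+ n.
    by exists (t ^+ n), (coefs g i); split; [exact: prime_notX|].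
  elim: n => [|n [g Pg fg]]; first by exists f => // j; rewrite mul1r mulr1.
  have [h gh] := coefs_in_div (PM g Pg).
  exists h => [|j].
    have : P (ps_cst p * h) by rewrite -gh; exact: PMl.
    by case/PP.
  have ghj : t * coefs g j = p * coefs h j by rewrite -!coef_cstM gh.
  by rewrite !exprS -mulrA fg mulrA ghj; ring.
- by move=> f0; have -> : f = 0 by apply: psP => n; rewrite (f0 n) /= if_same.
Qed.

Lemma height_coefs_in : height_eq (ps_coefs_in M) 1.
Proof.
have Mxp := coefs_in_prime Mprime; have [Mp p0 _ _] := punif.
have Zp : is_prime (ps_coefs_in [set 0 : A]).
  apply: coefs_in_prime; split; [split|..] => //.
  - by move=> _ _ -> ->; rewrite /= addr0.
  - by move=> a _ ->; rewrite /= mulr0.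
  - move=> h; have : [set 0] (1 : A) by rewrite h.
    by move=> /eqP; rewrite oner_eq0.
  - by move=> x y /= /eqP; rewrite mulf_eq0 => /orP[]/eqP; [left|right].
have Mi : is_ideal M by case: Mprime.
have ZM : ps_coefs_in [set 0] `<=` ps_coefs_in M.
  by move=> f f0 n; rewrite (f0 n); case: Mi.
have ZneM : ps_coefs_in [set 0] <> ps_coefs_in M.
  move=> e; have : ps_coefs_in M (ps_cst p) by exact: cst_coefs_in.
  by rewrite -e => /(_ 0%N).
split; apply/(height_geP Mxp).
  exists [set ps_coefs_in [set 0]; ps_coefs_in M]; split; first split.
  - by exists (ps_coefs_in M); right.
  - by move=> _ [->|->].
  - by move=> _ _ [->|->] [->|->]; [left|left|right|left].
  - by move=> _ [->|->].
  exists (ps_coefs_in [set 0]); first by left.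
  apply: (@card_le_inj _ _ _ _ (fun=> ps_coefs_in M)).
    by move=> _ _; split; [right|move=> /= /esym].
  by move=> [|x] [|y].
move=> [C [[_ Cp _] CM [P CP]]].
have Cdich Q : C Q -> Q = ps_coefs_in [set 0] \/ Q = ps_coefs_in M.
  by move=> CQ; apply: primes_below_coefs_in; [exact: Cp|exact: CM].
move=> I2; suff : (2 <= 1)%N by [].
rewrite -card_le_II; apply: (card_le_trans I2).
have sub1 (X : set (power_series A)) : C `\ P `<=` [set X] -> C `\ P #<= `I_1.
  move=> h; apply: (card_le_trans (subset_card_le h)).
  by have /card_eqPle[] := @card_set1 _ X.
have [PZ|PM] := Cdich P CP.
  by apply: (sub1 (ps_coefs_in M)) => Q [/Cdich[->|->]] // []; rewrite PZ.
by apply: (sub1 (ps_coefs_in [set 0])) => Q [/Cdich[->|->]] // []; rewrite PM.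
Qed.

End HeightOne.

(** * Approximating primes in systems of Dedekind domains *)

Section ApproximatingPrimes.
Variables (A : comPzRingType) (M : set A) (S : nat -> set A) (p : A) (n0 : nat).
Hypotheses (Mmax : is_maximal M) (Mp : M p).
Hypothesis Mloc : forall m, M m -> exists t d, ~ M t /\ t * m = d * p.
(** The sets [S n] play the role of the subrings D_n: [S_noeth] reflects that they are Noetherian,
    [S_max] that [M] contracts to a maximal ideal of D_n once D_n contains [p]. *)
Hypotheses (S_mono : forall m n, (m <= n)%N -> S m `<=` S n) (Sp : S n0 p).
Hypothesis S_cover : forall x, exists n, S n x.
Hypothesis S_noeth : forall n, exists2 s : seq A, [set` s] `<=` M &
  forall x, S n x -> M x -> ideal_gen [set` s] x.
Hypothesis S_max : forall n, (n0 <= n)%N -> forall N : set A, is_ideal N -> ~ N 1 ->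
  (forall x, S n x -> M x -> N x) -> forall x, S n x -> N x -> M x.
Hypothesis Mnfg : ~ finitely_generated M.

(* If [M] were the only maximal ideal containing [M `&` S n], which generates
   [M] locally at [M], then [M `&` S n] would generate [M]. *)
Lemma approximating_maximal n : (n0 <= n)%N -> exists N y,
  [/\ is_maximal N, M y, ~ N y & forall x, S n x -> (N x <-> M x)].
Proof.
move=> n0n; have [s sM sP] := S_noeth n.
have [Mi _ _] := maximal_prime Mmax; have [J0 JD JM] := ideal_gen_ideal [set` s].
have [m Mm nJm] : exists2 m, M m & ~ ideal_gen [set` s] m.
  apply: contrapT => /forall2NP h; apply: Mnfg; exists s; apply/seteqP.
  split; last exact: ideal_gen_sub.
  by move=> m Mm; have [//|/contrapT] := h m.
(* This colon ideal is proper because [m] is not generated by [s], and it contains [t], as t m = d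
   p. A maximal ideal above it thus differs from [M]. *)
have Ii : is_ideal [set x | ideal_gen [set` s] (x * m)].
  split=> [|x y Ix Iy|a x Ix]; first by rewrite /= mul0r.
    by rewrite /= mulrDl; exact: JD.
  by rewrite /= -mulrA; exact: JM.
have [|N Nmax IN] := maximal_exists Ii; first by rewrite /= mul1r.
have Np := maximal_prime Nmax; have [Ni _ _] := Np.
have [t [d [Mt td]]] := Mloc Mm.
have Nt : N t.
  by apply: IN; rewrite /= td; apply: JM; apply: sP => //; exact: (S_mono n0n Sp).
have [y My nNy] : exists2 y, M y & ~ N y.
  apply: contrapT => /forall2NP h; apply: Mt.
  rewrite -(maximal_eq Mmax Ni (prime_not1 Np)) // => y My.
  by have [//|/contrapT] := h y.
have MN x : S n x -> M x -> N x.
  by move=> Sx Mx; apply: IN; rewrite /= mulrC; apply: JM; exact: sP.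
exists N, y; split=> // x Sx; split; last exact: MN.
exact: (S_max n0n Ni (prime_not1 Np)).
Qed.

Lemma approximating_primes : exists (N : nat -> set A) (e : nat -> A),
  [/\ forall n, is_prime (N n),
      forall a, M a -> \oo [set n | N n a],
      forall a, ~ M a -> \oo [set n | ~ N n a],
      forall n, M (e n) /\ ~ N n (e n) &
      forall m n, m <> n -> N m (e n)].
Proof.
have ex n : exists q : set A * A * nat, (n0 <= n)%N ->
    [/\ is_maximal q.1.1, M q.1.2, ~ q.1.1 q.1.2,
        forall x, S n x -> (q.1.1 x <-> M x) & (n < q.2)%N /\ S q.2 q.1.2].
  have [n0n|] := leqP n0 n; last by exists (setT, 0, 0%N).
  have [N [y [Nmax My nNy NM]]] := approximating_maximal n0n.
  have [j Sj] := S_cover y; exists (N, y, maxn n.+1 j) => _; split=> //.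
  split; first exact: leq_maxl.
  by apply: S_mono Sj; exact: leq_maxr.
(* Each stage [k n.+1] contains the element [y n] of [M] chosen at stage [k n]. Later primes agree
   with [M] on that stage, hence contain [y n]. *)
have [q qP] := boolp.choice ex; pose k := fix k n :=
  if n is n'.+1 then (q (k n')).2 else n0.
have k_ge n : (n0 <= k n)%N.
  elim: n => //= n IH; have [_ _ _ _ [h _]] := qP _ IH.
  exact: leq_trans IH (ltnW h).
have k_lt n : (k n < k n.+1)%N by have [_ _ _ _ []] := qP _ (k_ge n).
have k_mono m n : (m <= n)%N -> (k m <= k n)%N.
  move=> mn; rewrite -(subnK mn); elim: (n - m)%N => //= i IH.
  exact: leq_trans IH (ltnW (k_lt _)).
have k_id n : (n <= k n)%N by elim: n => // n IH; exact: leq_ltn_trans (k_lt n).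
pose N n := (q (k n)).1.1; pose y n := (q (k n)).1.2.
have Nmax n : is_maximal (N n) by have [] := qP _ (k_ge n).
have Np n := maximal_prime (Nmax n).
have Ni n : is_ideal (N n) by case: (Np n).
have My n : M (y n) by have [] := qP _ (k_ge n).
have nNy n : ~ N n (y n) by have [] := qP _ (k_ge n).
have NM n x : S (k n) x -> (N n x <-> M x).
  by have [_ _ _ h _] := qP _ (k_ge n); exact: h.
have Ny n m : (n < m)%N -> N m (y n).
  move=> nm; apply/NM => //; have [_ _ _ _ [_]] := qP _ (k_ge n).
  exact: S_mono (k_mono _ _ nm) _.
have [z zP] := boolp.choice (fun n => maximal_bezout (Nmax n) (nNy n)).
have [Mi _ _] := maximal_prime Mmax.
(* The factor [1 - z l * y l] lies in [N l], which handles the indices below [n]; [y n] itself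
   handles those above. Modulo [N n] each factor is 1, since [y l] is in [N n] for [l < n]. *)
exists N, (fun n => y n * \prod_(l < n) (1 - z l * y l)); split=> //.
- move=> a Ma; have [j Sj] := S_cover a; exists j => // n /= jn; apply/NM => //.
  by apply: S_mono Sj; exact: leq_trans (k_id n).
- move=> a Ma; have [j Sj] := S_cover a; exists j => // n /= jn /NM h; apply/Ma/h.
  by apply: S_mono Sj; exact: leq_trans (k_id n).
- move=> n; split; first exact: is_idealMr.
  apply: prime_notM => //; apply: prime_not_prod => // l _ h.
  apply: (prime_not1 (Np n)); rewrite -(subrK (z l * y l) 1).
  by have [_ ND NMl] := Ni n; apply: ND => //; apply: NMl; exact: Ny.
move=> m n /eqP; rewrite neq_ltn => /orP[mn|nm].
  rewrite (bigD1 (Ordinal mn)) //= mulrCA; exact: is_idealMr.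
by apply: is_idealMr => //; exact: Ny.
Qed.

End ApproximatingPrimes.

(** * Ultrafilter, well-order and the resulting long chain *)

Lemma nonprincipal_ultrafilter :
  exists G : set_system nat, UltraFilter G /\ \oo `<=` G.
Proof. exact: ultraFilterLemma. Qed.

Lemma uncountable_set_nat : ~ countable [set: set nat].
Proof.
move=> /countable_injP[f f_inj]; pose d := [set n | exists2 X, f X = n & ~ X n].
have nd : ~ d (f d).
  move=> dd; have [X fX nX] := dd; apply: nX.
  by have -> : X = d by apply: f_inj; rewrite ?inE.
by apply: (nd); exists d.
Qed.

(** A well-ordering of the power set of the natural numbers supplies omega_1 levels for the tree.
    Infinitude is recorded as well because it is what refutes finite height. *)
Lemma two_aleph1_chain (A : comPzRingType) (M : set A) N e : is_prime M ->
  [/\ forall n, is_prime (N n),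
      forall a, M a -> \oo [set n | N n a],
      forall a, ~ M a -> \oo [set n | ~ N n a],
      forall n, M (e n) /\ ~ N n (e n) &
      forall m n, m <> n -> N m (e n)] ->
  exists C : set (set (power_series A)),
  [/\ prime_chain C, forall P, C P -> ps_ext M `<=` P /\ P `<=` ps_coefs_in M &
      exists2 P, C P & two_aleph1 #<= C `\ P /\ infinite_set (C `\ P)].
Proof.
move=> Mp [Np MN MNc eP Ne].
have [G [Gultra Goo]] := nonprincipal_ultrafilter.
have [R Rwo] := well_ordering_principle (set nat).
have uT := uncountable_set_nat.
have [tree treeE] := separating_tree Rwo succn.
have Me n : M (e n) by case: (eP n).
have nNe n : ~ N n (e n) by case: (eP n).
have [C [Cchain CM [P CP SC]]] :=
  prime_chain_branches Mp Np MN MNc Me nNe Ne Gultra Goo Rwo treeE.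
exists C; split=> //; exists P => //; split.
  apply: card_le_trans SC; have [h [hS h_inj]] := aleph1_le Rwo uT.
  apply: (@card_le_inj _ _ _ _ (fun B => h @` B)).
    by move=> B BA _ [t Bt <-]; apply/hS/BA.
  move=> B B' BA B'A hB; apply/seteqP; split=> t Bt.
    have [u B'u /h_inj <-//] : (h @` B') (h t) by rewrite -hB; exists t.
    - exact: B'A.
    - exact: BA.
  have [u B'u /h_inj <-//] : (h @` B) (h t) by rewrite hB; exists t.
  - exact: BA.
  - exact: B'A.
have : infinite_set (countable_initial R).
  by move=> /finite_set_countable; exact: countable_initial_uncountable.
move=> /infiniteP nS; apply/infiniteP; apply: card_le_trans SC.
(* Singletons of levels already give infinitely many branches. *)
apply: (card_le_trans nS); apply: (@card_le_inj _ _ _ _ set1).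
  by move=> x Sx _ ->.
by move=> x y _ _ xy; have : [set y] x by rewrite -xy.
Qed.

(** * Power series over a finitely generated ideal *)

Lemma ideal_gen_seqP (A : comPzRingType) (s : seq A) x : ideal_gen [set` s] x ->
  exists c : A -> A, x = \sum_(a <- undup s) a * c a.
Proof.
(* Coefficients are attached to elements and not to positions, so duplicates are removed for a
   generator to occur exactly once. *)
have Ii : is_ideal [set x | exists c : A -> A, x = \sum_(a <- undup s) a * c a].
  split=> [|_ _ [c ->] [d ->]|b _ [c ->]].
  - by exists (fun=> 0); rewrite big1 // => a _; rewrite mulr0.
  - exists (fun a => c a + d a); rewrite -big_split.
    by apply: eq_bigr => a _; rewrite mulrDr.
  - exists (fun a => b * c a); rewrite mulr_sumr.
    by apply: eq_bigr => a _; rewrite mulrCA.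
apply: (ideal_gen_sub Ii) => a sa; exists (fun b => (b == a)%:R).
rewrite (bigD1_seq a) ?undup_uniq ?mem_undup //= eqxx mulr1 big1 ?addr0 //.
by move=> b /negPf->; rewrite mulr0.
Qed.

(** Each coefficient is a combination of the same finitely many generators, so the multipliers of
    each generator are gathered into one series. *)
Lemma coefs_in_fg (A : comPzRingType) (M : set A) : finitely_generated M ->
  ps_coefs_in M `<=` ps_ext M.
Proof.
move=> [s Ms] f; rewrite {1}Ms => sf.
have [c fc] := boolp.choice (fun n => ideal_gen_seqP (sf n)).
have -> : f = \sum_(a <- undup s) ps_cst a * PowerSeries (fun n => c n a).
  apply: psP => n; rewrite fc; elim/big_rec2: _ => [|a x g _ ->].
    by rewrite /= if_same.
  by rewrite -[c n a]/(coefs (PowerSeries (c^~ a)) n) -coef_cstM.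
have [_ _ EM] := ideal_gen_ideal (@ps_cst A @` M).
rewrite big_seq; apply: ideal_sum => [|a]; first exact: ideal_gen_ideal.
rewrite mem_undup mulrC => sa; apply: EM; apply: sub_ideal_gen; exists a => //.
by rewrite Ms; exact: sub_ideal_gen.
Qed.

(** * The rings of a system inside their union *)

Section SystemSubrings.
Variables (L : idomainType) (Dn : nat -> subringClosed L) (D : subringClosed L).
Variable M : set (subring D).
Hypothesis Dsys : dedekind_system Dn.
Hypothesis DE : [set` D] = \bigcup_n [set` Dn n].
Hypothesis Mmax : is_maximal M.

Lemma system_mono m n : (m <= n)%N -> [set` Dn m] `<=` [set` Dn n].
Proof.
move=> mn; rewrite -(subnK mn); elim: (n - m)%N => //= i IH.
by apply: (subset_trans IH); have [/(_ (i + m)%N)[]] := Dsys.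
Qed.

Lemma system_sub n x : x \in Dn n -> x \in D.
Proof.
move=> xn; suff : [set` D] x by [].
by rewrite DE; exists n.
Qed.

Definition incl n (x : subring (Dn n)) : subring D :=
  exist _ (val x) (system_sub (valP x)).

Lemma inclD n : {morph @incl n : x y / x + y}.
Proof. by move=> x y; apply: val_inj. Qed.

Lemma inclM n : {morph @incl n : x y / x * y}.
Proof. by move=> x y; apply: val_inj. Qed.

Lemma incl0 n : @incl n 0 = 0.
Proof. exact: val_inj. Qed.

Lemma incl1 n : @incl n 1 = 1.
Proof. exact: val_inj. Qed.

Lemma incl_preimage_ideal n (I : set (subring D)) :
  is_ideal I -> is_ideal (@incl n @^-1` I).
Proof.
move=> [I0 ID IM]; split=> [|x y Ix Iy|a x Ix] /=; first by rewrite incl0.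
  by rewrite inclD; exact: ID.
by rewrite inclM; exact: IM.
Qed.

Lemma incl_preimage_prime n (I : set (subring D)) :
  is_prime I -> is_prime (@incl n @^-1` I).
Proof.
move=> Ip; have [Ii _ IP] := Ip; split; first exact: incl_preimage_ideal.
  move=> h; apply: (prime_not1 Ip); rewrite -(incl1 n).
  by have : (@incl n @^-1` I) 1 by rewrite h.
by move=> x y /=; rewrite inclM => /IP.
Qed.

Lemma inclP n (x : subring D) : val x \in Dn n -> exists x', @incl n x' = x.
Proof. by move=> xn; exists (exist _ (val x) xn); apply: val_inj. Qed.

Lemma system_approximating_primes p : uniformizer M p -> ~ finitely_generated M ->
  exists (N : nat -> set (subring D)) (e : nat -> subring D),
  [/\ forall n, is_prime (N n),
      forall a, M a -> \oo [set n | N n a],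
      forall a, ~ M a -> \oo [set n | ~ N n a],
      forall n, M (e n) /\ ~ N n (e n) &
      forall m n, m <> n -> N m (e n)].
Proof.
move=> [Mp p0 Mloc _] Mnfg; have [_ Ddk _ _ _] := Dsys.
have Mpr := maximal_prime Mmax; have [Mi _ _] := Mpr.
have cover (x : subring D) : exists n, val x \in Dn n.
  have [n _ xn] : (\bigcup_n [set` Dn n]) (val x) by rewrite -DE /=; exact: valP.
  by exists n.
have [n0 pn0] := cover p.
apply: (@approximating_primes _ M (fun n => [set x | val x \in Dn n]) p n0) => //.
- by move=> m n mn x; exact: system_mono.
- move=> n; have [noeth _ _] := Ddk n.
  have [s sE] := noeth _ (@incl_preimage_ideal n M Mi).
  exists [seq incl x | x <- s].
    move=> _ /mapP[x sx ->]; suff : (@incl n @^-1` M) x by [].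
    by rewrite sE; exact: sub_ideal_gen.
  move=> _ /inclP[x <-] Mx.
  have Ii := @incl_preimage_ideal n _ (ideal_gen_ideal [set` [seq incl x | x <- s]]).
  have : (@incl n @^-1` M) x by [].
  rewrite sE; apply: (ideal_gen_sub Ii) => y sy; apply: sub_ideal_gen.
  exact: map_f.
- move=> n n0n N Ni N1 MN _ /inclP[x <-] Nx; have [_ _ dim1] := Ddk n.
  have [p' p'E] := inclP (system_mono n0n pn0).
  (* The contraction is prime and contains the nonzero [p], hence is maximal in the Dedekind domain
     D_n. *)
  have Mnmax : is_maximal (@incl n @^-1` M).
    apply: dim1; first exact: incl_preimage_prime.
    move=> h; have : (@incl n @^-1` M) p' by rewrite /= p'E.
    by rewrite h => /= p'0; apply: p0; rewrite -p'E p'0 incl0.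
  have : (@incl n @^-1` N) x by [].
  suff -> : @incl n @^-1` N = @incl n @^-1` M by [].
  apply: maximal_eq => //; first exact: incl_preimage_ideal.
    by rewrite /= incl1.
  by move=> y My; apply: MN => //=; exact: valP.
Qed.

End SystemSubrings.

Theorem corollary2p9 (L : idomainType) (Dn : nat -> subringClosed L)
    (D : subringClosed L) (M : set (subring D)) :
  dedekind_system Dn ->
  [set` D] = \bigcup_n [set` Dn n] ->
  is_maximal M ->
  is_dvr (localization M) ->
  [<-> finitely_generated M;
       invertible_ideal M;
       height_eq (ps_coefs_in M) 1;
       height_finite (ps_coefs_in M)]
  /\
  (~ finitely_generated M <->
   height_ge (@quot_map _ (ps_ext M) @` ps_coefs_in M) two_aleph1).
Proof.
move=> Dsys DE Mmax Mdvr; have Mp := maximal_prime Mmax.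
have [Mi _ _] := Mp; have Mxp := coefs_in_prime Mp.
have [p punif] := dvr_uniformizer Mp Mdvr; have [pM p0 Mloc _] := punif.
(* One chain serves both parts: its infinitude contradicts finite height, its cardinality gives the
   bound modulo M D[[X]]. *)
have chain : ~ finitely_generated M -> exists C : set (set (power_series (subring D))),
  [/\ prime_chain C, forall P, C P -> ps_ext M `<=` P /\ P `<=` ps_coefs_in M &
      exists2 P, C P & two_aleph1 #<= C `\ P /\ infinite_set (C `\ P)].
  move=> /(system_approximating_primes Dsys DE Mmax punif)[N [e Ne]].
  exact: two_aleph1_chain Mp Ne.
split.
  tfae.
  - move=> Mfg; have [t Mt tM] := fg_locally_principal Mp Mfg Mloc.
    exact: locally_principal_invertible tM.
  - move=> /(invertible_fg Mi) Mfg.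
    have [t Mt tM] := fg_locally_principal Mp Mfg Mloc.
    exact: height_coefs_in tM.
  - by exists 1%N.
  - move=> [n [_ nh]]; apply: contrapT => /chain[C [Cch CM [P CP [_ Cinf]]]].
    apply: nh; apply/(height_geP Mxp); exists C; split=> // [Q /CM[]//|].
    exists P => //; apply: card_le_trans (_ : [set: nat] #<= _); last exact/infiniteP.
    exact: subset_card_le.
split=> [/chain[C [Cch CM [P CP [Ccard _]]]]|].
  by apply: (height_ge_quot Mxp Cch CM); exists P.
(* Now M[[X]] equals M D[[X]], so its image is the zero ideal, the only prime inside it is itself,
   and the chain has one member. *)
move=> hge Mfg; have MX := coefs_in_fg Mfg.
have extM : ps_ext M `<=` ps_coefs_in M.
  by apply: ps_ext_sub => [|a]; [exact: coefs_in_ideal|exact: cst_coefs_in].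
have Jp := quot_image_prime Mxp extM.
move: hge => /(height_geP Jp)[C [[_ Cp _] CJ [P CP]]].
have CE Q : C Q -> Q = quot_map (ps_ext M) @` ps_coefs_in M.
  move=> CQ; apply/seteqP; split=> [|_ [f Mf <-]]; first exact: CJ.
  have -> : quot_map (ps_ext M) f = 0.
    rewrite -(quot_map0 (ps_ext M)); apply/quot_mapP; rewrite subr0.
    by apply: sub_ideal_gen; exact: MX.
  by have [[]] := Cp Q CQ.
have -> : C `\ P = set0.
  by apply/seteqP; split=> // Q [CQ] /=; rewrite (CE Q CQ) (CE P CP).
(* The cardinal is nonzero: the empty set belongs to [two_aleph1]. *)
rewrite card_le0 => /eqP h; have : two_aleph1 set0 by exact: sub0set.
by rewrite h.
Qed.
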